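(* Let $R>0$ with $R<H(X)$. Below, each $o(1)$ denotes a sequence tending to $0$ as $n\to\infty$, and each inequality holds for all sufficiently large $n$. (i) If $\epsilon_n=1/\log(n)$, then $$-\frac1n\log\beta_n(\epsilon_n,R)-\xi(R)\ \ge\ \left(\frac16\frac{\partial D(R)}{\partial R}-\frac{\sqrt{2\ln(\log(n))}\,C(P_{XY})}{\log(n)}-o(1)\right)\frac{\log n}{n^{1/3}},$$ $$-\frac1n\log\beta_n(\epsilon_n,R)-\xi(R)\ \le\ \left(16\,C(P_{XY})+\frac{\log(\log(n))\sqrt{\log(n)}}{n}\right)\frac{1}{\sqrt{\log(n)}}.$$ (ii) If $\epsilon_n=1/n^{p}$ with $0<p<2$, then $$-\frac1n\log\beta_n(\epsilon_n,R)-\xi(R)\ \ge\ \left(\frac16\frac{\partial D(R)}{\partial R}-\frac{\sqrt{2p\ln(n)}}{\log n}\,C(P_{XY})-o(1)\right)\frac{\log n}{n^{1/3}},$$ $$-\frac1n\log\beta_n(\epsilon_n,R)-\xi(R)\ \le\ \left(16\,C(P_{XY})+\frac{p\log(n)}{n^{1-p/2}}\right)\frac{1}{n^{p/2}}.$$ (iii) If $\epsilon_n=1/n^{p}$ with $p\ge 2$, then $$-\frac1n\log\beta_n(\epsilon_n,R)-\xi(R)\ \ge\ \left(\frac16\frac{\partial D(R)}{\partial R}-\frac{\sqrt{2p\ln(n)}}{\log n}\,C(P_{XY})-o(1)\right)\frac{\log n}{n^{1/3}},$$ $$-\frac1n\log\beta_n(\epsilon_n,R)-\xi(R)\ \le\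 \left(8\sqrt2\,C(P_{XY})\frac{\sqrt{n^{2-p}+1}}{\log(n)}+2\right)\frac{\log(n)}{n}.$$ (iv) If $\epsilon_n=1/e^{n^{p}}$ with $p\in(0,1)$, then $$-\frac1n\log\beta_n(\epsilon_n,R)-\xi(R)\ \ge\ \left(\frac{(1-p)}{6}\frac{\partial D(R)}{\partial R}-\frac{\sqrt2\,C(P_{XY})}{\log(n)}-o(1)\right)\frac{\log n}{n^{(1-p)/3}},$$ $$-\frac1n\log\beta_n(\epsilon_n,R)-\xi(R)\ \le\ \left(8\sqrt2\,C(P_{XY})\frac{\sqrt{e^{-n^{p}}n^2+1}}{\log(n)}+2\right)\frac{\log(n)}{n}.$$
   Context: $\mathbb{X},\mathbb{Y}$ are finite alphabets and $(X,Y)$ is a random pair with values in $\mathbb{X}\times\mathbb{Y}$ and joint law $P_{XY}$, with marginals $P_X,P_Y$. Put $Q_{XY}=P_X\cdot P_Y$ (product law). It is assumed throughout that $\mathcal{D}(P_{XY}\|Q_{XY})=I(X;Y)>0$. $P_{XY}^n$ and $Q_{XY}^n$ denote the $n$-fold i.i.d. product laws on $\mathbb{X}^n\times\mathbb{Y}^n$. The logarithm $\log$ and all information quantities (entropy, mutual information, divergence) are taken to base 2, consistently with rates in bits per sample; $\ln$ is the natural logarithm. An encoder of length $n$ and rate $R$ is a map $f_n:\mathbb{X}^n\to\{1,\dots,2^{nR}\}$ (integers $i$ with $1\le i\le 2^{nR}$); a decoder (detector) is a map $\phi_n:\{1,\dots,2^{nR}\}\times\mathbb{Y}^n\to\{0,1\}$.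 Let $\mathcal{A}(f_n,\phi_n)=\{(x_1^n,y_1^n)\in\mathbb{X}^n\times\mathbb{Y}^n:\phi_n(f_n(x_1^n),y_1^n)=0\}$, and define the Type I and Type II error probabilities $$P_0(f_n,\phi_n)=P_{XY}^n(\mathcal{A}^c(f_n,\phi_n)),\qquad P_1(f_n,\phi_n)=Q_{XY}^n(\mathcal{A}(f_n,\phi_n)).$$ For $\epsilon>0$, $$\beta_n(\epsilon,R)=\min_{(f_n,\phi_n)}\{P_1(f_n,\phi_n):P_0(f_n,\phi_n)\le\epsilon\},$$ the minimum being over all encoder-decoder pairs of length $n$ and rate $R$. In the following, $U$ ranges over random variables with values in a finite alphabet $\mathbb{U}$, jointly distributed with $(X,Y)\sim P_{XY}$, and ''$U-X-Y$ is a Markov chain'' means that $U$ and $Y$ are conditionally independent given $X$: $$\xi(R)=\max\{I(U;Y): U-X-Y \text{ is a Markov chain},\ I(U;X)\le R,\ |\mathbb{U}|\le|\mathbb{X}|+1\},$$ and the noisy distortion-rate function is $$D(R)=\min\{H(Y|U): U-X-Y \text{ is a Markov chain},\ I(U;X)\le R,\ |\mathbb{U}|\le|\mathbb{X}|+1\},$$ with $\frac{\partial D(R)}{\partial R}$ its derivative with respect to the rate, evaluated at $R$. Finally, $$C(P_{XY})=\sup_{(x,y)\in\mathbb{X}\times\mathbb{Y}}\left|\log\left(\frac{P_{XY}(\{(x,y)\})}{Q_{XY}(\{(x,y)\})}\right)\right|,$$ and it is assumed that $C(P_{XY})<\infty$. *)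

(* Defs.v *)
(* Built on MathComp-Analysis.  Laws on finite types are given by their mass
   functions. *)
From HB Require Import structures.
From mathcomp Require Import all_boot all_order all_algebra.
From mathcomp Require Import all_classical all_reals all_analysis.

Set Implicit Arguments.
Unset Strict Implicit.
Unset Printing Implicit Defensive.

Import Order.TTheory GRing.Theory Num.Theory.
Import numFieldNormedType.Exports.

Local Open Scope classical_set_scope.
Local Open Scope ring_scope.

Section information_measures.
Variable R : realType.
Implicit Types A B : finType.

(* Base-2 logarithm; ln 0 = 0 in the library, so the summands 0 * log2 0 below
   follow the usual convention 0 log 0 = 0. *)
Definition log2 (t : R) : R := ln t / ln 2.

Definition is_pmf A (p : A -> R) : Prop :=
  (forall a, 0 <= p a) /\ \sum_(a : A) p a = 1.

Definition fst_marg A B (p : A * B -> R) (a : A) : R := \sum_(b : B) p (a, b).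
Definition snd_marg A B (p : A * B -> R) (b : B) : R := \sum_(a : A) p (a, b).

Definition prod_marg A B (p : A * B -> R) (ab : A * B) : R :=
  fst_marg p ab.1 * snd_marg p ab.2.

Definition entropy A (p : A -> R) : R := - \sum_(a : A) p a * log2 (p a).

(* H(B | A) for (A, B) ~ p *)
Definition cond_entropy A B (p : A * B -> R) : R :=
  - \sum_(ab : A * B) p ab * log2 (p ab / fst_marg p ab.1).

(* The divergence D(p || q), used only when p is absolutely continuous with
   respect to q (otherwise it would be infinite). *)
Definition divergence A (p q : A -> R) : R :=
  \sum_(a : A) p a * log2 (p a / q a).

Definition mutual_info A B (p : A * B -> R) : R :=
  divergence p (prod_marg p).

(* lne is the extended logarithm, with lne 0 = -oo: the supremum is infinite as
   soon as P vanishes at a point where the product law does not.  Points where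
   both laws vanish, at which the ratio is undefined, are left out. *)
Definition llr_bound A B (p : A * B -> R) : \bar R :=
  ereal_sup [set `|lne (p ab / prod_marg p ab)%:E * ((ln 2)^-1)%:E|%E
            | ab in [set ab | prod_marg p ab != 0]].

End information_measures.

Section noisy_rate_distortion.
Variables (R : realType) (X Y : finType) (P : X * Y -> R).

(* A joint law of (U, X, Y) is a mass function on U * X * Y, that is, on
   (U * X) * Y. *)
Section joint_law.
Variables (U : finType) (W : U * X * Y -> R).

Definition law_UX (ux : U * X) : R := \sum_(y : Y) W (ux, y).
Definition law_UY (uy : U * Y) : R := \sum_(x : X) W (uy.1, x, uy.2).
Definition law_XY (xy : X * Y) : R := \sum_(u : U) W (u, xy.1, xy.2).
Definition law_X (x : X) : R := \sum_(u : U) \sum_(y : Y) W (u, x, y).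

Definition markov : Prop := forall u x y, law_X x != 0 ->
  W (u, x, y) / law_X x = (law_UX (u, x) / law_X x) * (law_XY (x, y) / law_X x).

Definition admissible (r : R) : Prop :=
  [/\ is_pmf W, law_XY =1 P, markov, mutual_info law_UX <= r
    & (#|U| <= #|X| + 1)%N].
End joint_law.

(* Maximum and minimum are taken as sup and inf of sets of reals: for r >= 0 the
   sets are nonempty and bounded (U constant is admissible), and the extrema are
   attained since the laws W on a fixed alphabet form a compact set. *)
Definition xi (r : R) : R :=
  sup [set t | exists (U : finType) (W : U * X * Y -> R),
                 admissible W r /\ t = mutual_info (law_UY W)].

Definition noisy_dist_rate (r : R) : R :=
  inf [set t | exists (U : finType) (W : U * X * Y -> R),
                 admissible W r /\ t = cond_entropy (law_UY W)].

End noisy_rate_distortion.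

Section testing.
Variables (R : realType) (X Y : finType).

Definition iid_law (p : X * Y -> R) (n : nat)
    (xy : n.-tuple X * n.-tuple Y) : R :=
  \prod_(i < n) p (tnth xy.1 i, tnth xy.2 i).

(* The number of integers i with 1 <= i <= 2 ^ (n r); the message i is encoded
   as the element i - 1 of 'I_(nb_messages n r). *)
Definition nb_messages (n : nat) (r : R) : nat :=
  Num.truncn (2 `^ (n%:R * r)).

Definition encoder (n : nat) (r : R) := n.-tuple X -> 'I_(nb_messages n r).

(* The decision 0 is false and the decision 1 is true. *)
Definition detector (n : nat) (r : R) :=
  'I_(nb_messages n r) * n.-tuple Y -> bool.

Section errors.
Variables (P : X * Y -> R) (n : nat) (r : R).
Variables (f : encoder n r) (phi : detector n r).

Definition accept : {set n.-tuple X * n.-tuple Y} :=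
  [set xy | phi (f xy.1, xy.2) == false]%SET.

Definition err0 : R := \sum_(xy in ~: accept) iid_law P xy.
Definition err1 : R := \sum_(xy in accept) iid_law (prod_marg P) xy.
End errors.

(* The minimum over the finitely many pairs (f, phi); when eps >= 0 the detector
   that always decides 0 is feasible. *)
Definition beta (P : X * Y -> R) (n : nat) (eps r : R) : R :=
  inf [set b | exists (f : encoder n r) (phi : detector n r),
                 err0 P f phi <= eps /\ b = err1 P f phi].

Definition exponent_gap (P : X * Y -> R) (n : nat) (eps r : R) : R :=
  - n%:R^-1 * log2 (beta P n eps r) - xi P r.

End testing.

(* Main.v *)
Require Import Defs.
From HB Require Import structures.
From mathcomp Require Import all_boot all_order all_algebra.
From mathcomp Require Import all_classical all_reals all_analysis.
From mathcomp Require Import ring lra.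

(* Upper bounds.  A test with type I error eps and type II error beta satisfies
   (1 - eps) log (1 / beta) - O(1) <= I(f(X^n); Y^n) by data processing, and the right
   side is at most n xi(r): the chain rule and the nonnegativity of conditional mutual
   information single-letterize it, and linear programming reduces the auxiliary
   alphabet to |X| + 1 letters.  As xi <= C, the gap is at most 2 C eps + 4 / n, which
   each of the claimed bounds dominates.

   Lower bounds.  A codebook chosen greedily, one codeword at a time so as to cover the
   largest remaining mass of source words, together with a likelihood ratio test, is
   analysed by Chernoff bounds whose constants do not depend on the auxiliary
   variable.  A fraction of the auxiliary variable is erased to make room in the rate.
   This gives a gap of at least - K n^(-(1-q)/2) as soon as eps_n >= exp (- n^q).  Since
   D is nonincreasing, the term in its derivative only lowers the claimed bound, and
   o(1) = K / log n suffices, with q = 1/3 in (i)-(iii) and q = p in (iv). *)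

Set Implicit Arguments.
Unset Strict Implicit.
Unset Printing Implicit Defensive.
Import Order.TTheory GRing.Theory Num.Theory.
Import numFieldNormedType.Exports.
Local Open Scope classical_set_scope.
Local Open Scope ring_scope.

(** * Mutual information *)

Section Information.
Variable R : realType.
Implicit Types A B U : finType.

(** The optimum defining [xi] is never shown to be attained. The lower bounds use an auxiliary
    variable that is optimal up to an error tending to 0; it changes with [n], and its letters may
    have arbitrarily small masses, so every constant must depend on [P] and the rate alone. The
    output density is bounded on both sides by the log-likelihood bound; the input density is
    bounded only from above, and its second moment is controlled instead. A joint law is handled as
    a family of unnormalized rows, one for each auxiliary letter, and in nats: nothing is
    conditioned on a letter of mass 0, and information is additive over letters, hence affine under
    time sharing and erasure. In the lower bounds a single small scale [s] governs the accuracy in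
    [xi], the Chernoff parameter, the slack in the two densities and the erased fraction, while
    [n s^2] is the exponent of the type I error; [n s^2 = n^q] is what produces the rate
    [n^(-(1-q)/2)]. *)

Lemma ln_le_subr1 (t : R) : 0 < t -> ln t <= t - 1.
Proof.
move=> t0; have := @le_ln1Dx R (t - 1); rewrite addrCA subrr addr0; apply; lra.
Qed.

(* Summed over the alphabet, the variational lower bound on a divergence. *)
Lemma mul_ln_div_ge (p q g : R) : 0 <= p -> 0 <= q -> (q = 0 -> p = 0) ->
  p * g + p - q * expR g <= p * ln (p / q).
Proof.
move=> p0 q0 pq; have e0 := expR_gt0 g.
have [p_eq0|p_neq0] := eqVneq p 0.
  rewrite p_eq0 !mul0r !add0r oppr_le0; exact: mulr_ge0 q0 (ltW e0).
have {}p0 : 0 < p by rewrite lt_neqAle eq_sym p_neq0.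
have {}q0 : 0 < q by rewrite lt_neqAle eq_sym q0 andbT; apply: contra_neq p_neq0.
have qep : 0 < q * expR g / p by rewrite divr_gt0 ?mulr_gt0.
have := ln_le_subr1 qep.
rewrite ln_div ?posrE ?mulr_gt0// lnM ?posrE// expRK ln_div ?posrE//.
rewrite -(ler_pM2l p0) => h.
have -> : q * expR g = p * (q * expR g / p) by field; rewrite gt_eqF.
rewrite mulrBr !mulrBr mulrDr mulr1 in h *; lra.
Qed.

Lemma sum_pair A B (F : A * B -> R) : \sum_ab F ab = \sum_a \sum_b F (a, b).
Proof. by rewrite pair_bigA; apply: eq_bigr => -[]. Qed.

(* The summand of the mutual information given by one value of the auxiliary
   variable; it is homogeneous in the unnormalized row [m]. *)
Definition row_info A (pA m : A -> R) : R :=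
  \sum_a m a * ln (m a / ((\sum_a' m a') * pA a)).

Definition info U A (pA : A -> R) (w : U -> A -> R) : R :=
  \sum_u row_info pA (w u).

Definition push A B (k : A -> B -> R) (m : A -> R) (b : B) : R :=
  \sum_a m a * k a b.

Definition coupling U A (pA : A -> R) (w : U -> A -> R) : Prop :=
  (forall u a, 0 <= w u a) /\ (forall a, \sum_u w u a = pA a).

Definition channel A B (k : A -> B -> R) : Prop :=
  (forall a b, 0 <= k a b) /\ (forall a, \sum_b k a b = 1).

Lemma row_infoZ A (pA m : A -> R) c : 0 <= c ->
  row_info pA (fun a => c * m a) = c * row_info pA m.
Proof.
rewrite le_eqVlt => /orP[/eqP<-|c0]; rewrite /row_info.
  by rewrite mul0r big1// => a _; rewrite mul0r mul0r.
rewrite mulr_sumr; apply: eq_bigr => a _; rewrite -mulr_sumr.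
rewrite -[c * m a * ln _]mulrA; congr (_ * (_ * ln _)).
by rewrite -mulrA invfM mulrACA mulfV ?mul1r// gt_eqF.
Qed.

Lemma pushZ A B (k : A -> B -> R) (m : A -> R) c :
  push k (fun a => c * m a) = fun b => c * push k m b.
Proof.
by apply/funext => b; rewrite /push mulr_sumr; apply: eq_bigr => a _; rewrite mulrA.
Qed.

Lemma push_mass A B (k : A -> B -> R) (m : A -> R) : channel k ->
  \sum_b push k m b = \sum_a m a.
Proof.
move=> [_ k1]; rewrite exchange_big; apply: eq_bigr => a _.
by rewrite -mulr_sumr k1 mulr1.
Qed.

Lemma push_ge0 A B (k : A -> B -> R) (m : A -> R) : channel k ->
  (forall a, 0 <= m a) -> forall b, 0 <= push k m b.
Proof. by move=> [k0 _] m0 b; apply: sumr_ge0 => a _; rewrite mulr_ge0. Qed.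

Lemma coupling_push U A B (k : A -> B -> R) pA (w : U -> A -> R) : channel k ->
  coupling pA w -> coupling (push k pA) (fun u => push k (w u)).
Proof.
move=> hk [w0 wA]; split=> [u|b]; first exact: push_ge0.
by rewrite exchange_big; apply: eq_bigr => a _; rewrite -wA mulr_suml.
Qed.

Lemma coupling_le_row U A pA (w : U -> A -> R) u a : coupling pA w ->
  w u a <= \sum_a' w u a'.
Proof.
by move=> [w0 _]; rewrite (bigD1 a)//= lerDl; apply: sumr_ge0.
Qed.

Lemma coupling_le_col U A pA (w : U -> A -> R) u a : coupling pA w -> w u a <= pA a.
Proof.
by move=> [w0 <-]; rewrite (bigD1 u)//= lerDl; apply: sumr_ge0.
Qed.

Lemma coupling_ge0 U A pA (w : U -> A -> R) a : coupling pA w -> 0 <= pA a.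
Proof. by move=> [w0 <-]; apply: sumr_ge0. Qed.

Lemma coupling_eq0 U A pA (w : U -> A -> R) u a : coupling pA w ->
  (\sum_a' w u a') * pA a = 0 -> w u a = 0.
Proof.
move=> cw /eqP; have w0 := cw.1; rewrite mulf_eq0 => /orP[] /eqP h;
  apply: le_anti; rewrite w0 andbT.
  by rewrite -h (coupling_le_row _ _ cw).
by rewrite -h (coupling_le_col _ _ cw).
Qed.

Lemma coupling_mass U A pA (w : U -> A -> R) : coupling pA w ->
  \sum_u \sum_a w u a = \sum_a pA a.
Proof. by move=> [_ wA]; rewrite exchange_big; apply: eq_bigr. Qed.

(** The Donsker-Varadhan bound, with a linear term in [expR g] in place of the logarithm of a
    partition function. It is used with [g = 0] for nonnegativity and with a two-valued [g] for the
    converse. *)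
Lemma info_ge U A (pA : A -> R) (w : U -> A -> R) (g : U -> A -> R) :
  coupling pA w -> \sum_a pA a = 1 ->
  \sum_u \sum_a w u a * g u a + 1
    - \sum_u \sum_a (\sum_a' w u a') * pA a * expR (g u a) <= info pA w.
Proof.
move=> cw p1; have w0 := cw.1.
rewrite -{1}p1 -(coupling_mass cw) -big_split -sumrB; apply: ler_sum => u _ /=.
rewrite -big_split -sumrB; apply: ler_sum => a _ /=.
apply: mul_ln_div_ge => //; last exact: (coupling_eq0 cw).
by apply: mulr_ge0; [apply: sumr_ge0|exact: coupling_ge0 cw].
Qed.

Lemma info_ge0 U A (pA : A -> R) (w : U -> A -> R) :
  coupling pA w -> \sum_a pA a = 1 -> 0 <= info pA w.
Proof.
move=> cw p1; apply: le_trans (info_ge (fun _ _ => 0) cw p1).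
under eq_bigr do under eq_bigr do rewrite mulr0.
under eq_bigr do rewrite big1//.
rewrite big1// add0r.
under eq_bigr do under eq_bigr do rewrite expR0 mulr1.
under eq_bigr do rewrite -mulr_sumr p1 mulr1.
by rewrite (coupling_mass cw) p1 subrr.
Qed.

(** Under the reference law the two components are independent, so I(U; A | B) equals I(U, B; A):
    the auxiliary variable of the first component is the pair of [U] and the second component. *)
Lemma info_chain U A B (pA : A -> R) (pB : B -> R) (w : U -> A * B -> R) :
  coupling (fun ab => pA ab.1 * pB ab.2) w -> (forall a, 0 <= pA a) -> \sum_a pA a = 1 ->
  (forall b, 0 <= pB b) ->
  info (fun ab => pA ab.1 * pB ab.2) w =
    info pB (fun u b => \sum_a w u (a, b)) +
    info pA (fun (ub : U * B) a => w ub.1 (a, ub.2)).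
Proof.
move=> cw pA0 pA1 pB0; have w0 := cw.1.
rewrite /info sum_pair/=.
rewrite -big_split; apply: eq_bigr => u _ /=.
rewrite /row_info -big_split/=.
have sE : \sum_b \sum_a w u (a, b) = \sum_ab w u ab.
  by rewrite exchange_big sum_pair.
rewrite sE.
have -> : \sum_(ab : A * B) w u ab * ln (w u ab / ((\sum_a' w u a') * (pA ab.1 * pB ab.2)))
  = \sum_b \sum_a w u (a, b) * ln (w u (a, b) / ((\sum_a' w u a') * (pA a * pB b))).
  by rewrite [LHS]sum_pair exchange_big.
apply: eq_bigr => b _; rewrite mulr_suml -big_split/=; apply: eq_bigr => a _.
have [->|wn0] := eqVneq (w u (a, b)) 0; first by rewrite !mul0r addr0.
have w_gt0 : 0 < w u (a, b) by rewrite lt_neqAle eq_sym wn0 w0.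
have pab : 0 < pA a * pB b by apply: lt_le_trans w_gt0 (coupling_le_col _ (a, b) cw).
have pa : 0 < pA a.
  by rewrite lt_neqAle pA0 andbT eq_sym; apply: contraTneq pab => ->; rewrite mul0r ltxx.
have pb : 0 < pB b.
  by rewrite lt_neqAle pB0 andbT eq_sym; apply: contraTneq pab => ->; rewrite mulr0 ltxx.
have m1 : 0 < \sum_a w u (a, b).
  by rewrite (bigD1 a)//= ltr_pwDl// sumr_ge0.
have m2 : 0 < \sum_a w u a by apply: lt_le_trans w_gt0 (coupling_le_row _ _ cw).
rewrite -mulrDr; congr (_ * _); rewrite -lnM ?posrE ?divr_gt0 ?mulr_gt0//.
congr ln; field.
by rewrite !gt_eqF.
Qed.

Lemma coupling_rest U A B (pA : A -> R) (pB : B -> R) (w : U -> A * B -> R) :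
  coupling (fun ab => pA ab.1 * pB ab.2) w -> \sum_a pA a = 1 ->
  coupling pB (fun u b => \sum_a w u (a, b)).
Proof.
move=> [w0 wAB] pA1; split=> [u b|b]; first exact: sumr_ge0.
rewrite exchange_big; under eq_bigr do rewrite wAB/=.
by rewrite -mulr_suml pA1 mul1r.
Qed.

Lemma coupling_letter U A B (pA : A -> R) (pB : B -> R) (w : U -> A * B -> R) :
  coupling (fun ab => pA ab.1 * pB ab.2) w -> \sum_b pB b = 1 ->
  coupling pA (fun (ub : U * B) a => w ub.1 (a, ub.2)).
Proof.
move=> [w0 wAB] pB1; split=> [[u b] a|a]//=.
rewrite sum_pair/= exchange_big.
under eq_bigr do rewrite wAB/=.
by rewrite -mulr_sumr pB1 mulr1.
Qed.

Lemma channel_prod A B A' B' (k : A -> A' -> R) (l : B -> B' -> R) :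
  channel k -> channel l ->
  channel (fun ab (ab' : A' * B') => k ab.1 ab'.1 * l ab.2 ab'.2).
Proof.
move=> [k0 k1] [l0 l1]; split=> [ab ab'|[a b]/=]; first exact: mulr_ge0.
rewrite sum_pair/=.
by under eq_bigr do rewrite -mulr_sumr l1 mulr1.
Qed.

(* The difference of the two sides is the conditional mutual information of the
   second input and the first output given the second output. *)
Lemma row_info_push_le A B A' B' (k : A -> A' -> R) (l : B -> B' -> R)
    (qA : A' -> R) (qB : B' -> R) (m : A * B -> R) :
  channel k -> channel l -> (forall ab, 0 <= m ab) ->
  (forall b a', push k (fun a => m (a, b)) a' <= qA a') ->
  (forall b', push l (fun b => \sum_a m (a, b)) b' <= qB b') ->
  row_info (fun ab => qA ab.1 * qB ab.2)
    (push (fun ab ab' => k ab.1 ab'.1 * l ab.2 ab'.2) m) <=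
  row_info qB (push l (fun b => \sum_a m (a, b))) +
  \sum_b row_info qA (push k (fun a => m (a, b))).
Proof.
move=> hk hl m0 leA leB.
pose q b a' := push k (fun a => m (a, b)) a'.
pose m1 b := \sum_a m (a, b).
pose h b' := push l m1 b'.
pose s := \sum_ab m ab.
pose g a' b' := push (fun ab ab' => k ab.1 ab'.1 * l ab.2 ab'.2) m (a', b').
pose j b a' b' := q b a' * l b b'.
have l0 := hl.1.
have q0 b a' : 0 <= q b a' by exact: push_ge0.
have j0 b a' b' : 0 <= j b a' b' by exact: mulr_ge0.
have m1q b : \sum_a' q b a' = m1 b by exact: push_mass.
have gE a' b' : g a' b' = \sum_b j b a' b'.
  rewrite /g /push sum_pair/= exchange_big; apply: eq_bigr => b _; rewrite /j /q /push mulr_suml.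
  by apply: eq_bigr => a _; rewrite mulrA.
have hE b' : h b' = \sum_b \sum_a' j b a' b'.
  by apply: eq_bigr => b _; rewrite -mulr_suml m1q.
have qE b a' : q b a' = \sum_b' j b a' b' by rewrite -mulr_sumr hl.2 mulr1.
have sE : \sum_b m1 b = s by rewrite exchange_big /s sum_pair.
(* The comparison law under which [b] and [a'] are independent given [b']. The inequality [key] is
   [j * ln (j / r) >= j - r]; summed over all indices the right side vanishes, because [j] and [r]
   have the same sum over [b]. *)
pose r b a' b' := m1 b * l b b' * (g a' b' / h b').
have g_h a' b' : g a' b' <= h b'.
  by rewrite gE hE; apply: ler_sum => b _; rewrite (bigD1 a')//= lerDl sumr_ge0.
have h0 b' : 0 <= h b' by rewrite hE; do 2!apply: sumr_ge0 => ? _.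
have g0 a' b' : 0 <= g a' b' by rewrite gE; apply: sumr_ge0.
have rE a' b' : \sum_b r b a' b' = g a' b'.
  rewrite -mulr_suml; change (h b' * (g a' b' / h b') = g a' b'); have [hb0|hb0] := eqVneq (h b') 0.
    by rewrite hb0 mul0r; apply: le_anti; rewrite g0 -hb0 g_h.
  by rewrite mulrC divfK.
pose L0 a' b' := ln (g a' b' / (s * (qA a' * qB b'))).
pose L1 b' := ln (h b' / (s * qB b')).
pose L2 b a' := ln (q b a' / (m1 b * qA a')).
have key b a' b' : j b a' b' * L0 a' b' + j b a' b' - r b a' b' <=
    j b a' b' * L1 b' + j b a' b' * L2 b a'.
  have r0 : 0 <= r b a' b'.
    by apply: mulr_ge0; [apply: mulr_ge0 => //; exact: sumr_ge0|exact: divr_ge0].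
  have [->|jn0] := eqVneq (j b a' b') 0; first by rewrite !mul0r !add0r oppr_le0.
  have j_gt0 : 0 < j b a' b' by rewrite lt_neqAle eq_sym jn0 j0.
  have qn0 : q b a' != 0 by apply: contra_neq jn0; rewrite /j => ->; rewrite mul0r.
  have ln0 : l b b' != 0 by apply: contra_neq jn0; rewrite /j => ->; rewrite mulr0.
  have q_gt0 : 0 < q b a' by rewrite lt_neqAle eq_sym qn0 q0.
  have l_gt0 : 0 < l b b' by rewrite lt_neqAle eq_sym ln0 l0.
  have g_gt0 : 0 < g a' b'.
    by rewrite gE (bigD1 b)//= ltr_pwDl// sumr_ge0.
  have h_gt0 : 0 < h b' by apply: lt_le_trans g_gt0 _.
  have m1_gt0 : 0 < m1 b by rewrite -m1q (bigD1 a')//= ltr_pwDl// sumr_ge0.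
  have s_gt0 : 0 < s.
    by rewrite -sE (bigD1 b)//= ltr_pwDl// sumr_ge0// => ? _; rewrite sumr_ge0.
  have qA_gt0 : 0 < qA a' by apply: lt_le_trans q_gt0 (leA _ _).
  have qB_gt0 : 0 < qB b' by apply: lt_le_trans h_gt0 (leB _).
  have r_gt0 : 0 < r b a' b' by apply: mulr_gt0; [exact: mulr_gt0|exact: divr_gt0].
  have := @mul_ln_div_ge _ _ 0 (ltW j_gt0) (ltW r_gt0); rewrite expR0 mulr0 add0r mulr1.
  move=> hj; have {}hj : j b a' b' - r b a' b' <= j b a' b' * ln (j b a' b' / r b a' b').
    by apply: hj => re; rewrite re ltxx in r_gt0.
  rewrite -addrA -lerBrDl; apply: le_trans hj _.
  rewrite -mulrDr -mulrBr; rewrite le_eqVlt; apply/orP; left; apply/eqP.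
  have sB : 0 < h b' / (s * qB b') by rewrite divr_gt0// mulr_gt0.
  have sA : 0 < q b a' / (m1 b * qA a') by rewrite divr_gt0// mulr_gt0.
  have sAB : 0 < g a' b' / (s * (qA a' * qB b')) by rewrite divr_gt0// !mulr_gt0.
  have sBA := mulr_gt0 sB sA.
  rewrite /L1 /L2 /L0 -lnM// -ln_div//.
  congr (_ * ln _); rewrite /r /j; field.
  by rewrite !gt_eqF.
have : \sum_b \sum_a' \sum_b' (j b a' b' * L0 a' b' + j b a' b' - r b a' b') <=
    \sum_b \sum_a' \sum_b' (j b a' b' * L1 b' + j b a' b' * L2 b a').
  by do 3![apply: ler_sum => ? _].
have swap (F : B -> A' -> B' -> R) :
    \sum_b \sum_a' \sum_b' F b a' b' = \sum_a' \sum_b' \sum_b F b a' b'.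
  by rewrite exchange_big; apply: eq_bigr => a' _; rewrite exchange_big.
have -> : \sum_b \sum_a' \sum_b' (j b a' b' * L0 a' b' + j b a' b' - r b a' b') =
    \sum_b \sum_a' \sum_b' j b a' b' * L0 a' b'.
  rewrite [LHS]swap [RHS]swap; apply: eq_bigr => a' _; apply: eq_bigr => b' _.
  by rewrite sumrB big_split/= rE -gE addrK.
have -> : row_info (fun ab => qA ab.1 * qB ab.2)
    (push (fun ab ab' => k ab.1 ab'.1 * l ab.2 ab'.2) m) =
    \sum_b \sum_a' \sum_b' j b a' b' * L0 a' b'.
  rewrite /row_info (push_mass _ (channel_prod hk hl)) [LHS]sum_pair swap.
  apply: eq_bigr => a' _; apply: eq_bigr => b' _.
  by rewrite -mulr_suml -gE.
move=> /le_trans; apply.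
under eq_bigr do under eq_bigr do rewrite big_split/= -mulr_suml -qE.
under eq_bigr do rewrite big_split/=.
rewrite big_split/= lerD//; rewrite le_eqVlt; apply/orP; left; apply/eqP.
  rewrite swap exchange_big /row_info push_mass// sE; apply: eq_bigr => b' _.
  rewrite exchange_big /= -/(h b') -/(L1 b') hE mulr_suml; apply: eq_bigr => b _.
  by rewrite mulr_suml.
by apply: eq_bigr => b _; rewrite /row_info push_mass.
Qed.

(** The auxiliary variable of the first letter contains the rest of the input, not of the output. It
    is thus the same variable as in [info_chain], and it reaches the output through the channel
    alone; the price is an inequality. *)
Lemma info_push_chain U A B A' B' (pA : A -> R) (pB : B -> R)
    (k : A -> A' -> R) (l : B -> B' -> R) (w : U -> A * B -> R) :
  coupling (fun ab => pA ab.1 * pB ab.2) w -> is_pmf pA -> is_pmf pB ->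
  channel k -> channel l ->
  info (fun ab => push k pA ab.1 * push l pB ab.2)
       (fun u => push (fun ab ab' => k ab.1 ab'.1 * l ab.2 ab'.2) (w u)) <=
    info (push l pB) (fun u => push l (fun b => \sum_a w u (a, b))) +
    info (push k pA) (fun (ub : U * B) => push k (fun a => w ub.1 (a, ub.2))).
Proof.
move=> cw [_ pA1] [_ pB1] hk hl.
have cA := coupling_push hk (coupling_letter cw pB1).
have cB := coupling_push hl (coupling_rest cw pA1).
rewrite [X in _ <= _ + X]/info sum_pair/= -big_split; apply: ler_sum => u _.
apply: row_info_push_le => //; first exact: cw.1.
- by move=> b a'; exact: (coupling_le_col (u, b) a' cA).
- by move=> b'; exact: (coupling_le_col u b' cB).
Qed.

End Information.

(** * Time sharing and the cardinality of the auxiliary alphabet *)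

Section Mixtures.
Variable R : realType.
Implicit Types A B U : finType.

Lemma row_info_mass0 A (pA m : A -> R) : (forall a, 0 <= m a) ->
  \sum_a m a = 0 -> row_info pA m = 0.
Proof.
move=> m0 /(psumr_eq0P (fun a _ => m0 a)) mE.
by rewrite /row_info big1// => a _; rewrite mE// mul0r.
Qed.

(** The disjoint union keeps the time-sharing switch inside the auxiliary variable, which makes the
    input and output informations affine in [t]. *)
Definition mixture U1 U2 A (t : R) (w1 : U1 -> A -> R) (w2 : U2 -> A -> R)
    (u : U1 + U2) : A -> R :=
  match u with
  | inl u1 => fun a => t * w1 u1 a
  | inr u2 => fun a => (1 - t) * w2 u2 a
  end.

Section mixture.
Variables (U1 U2 A B : finType) (t : R) (pA : A -> R) (pB : B -> R) (k : A -> B -> R).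
Variables (w1 : U1 -> A -> R) (w2 : U2 -> A -> R).
Hypotheses (t0 : 0 <= t) (t1 : t <= 1).

Lemma mixture_coupling : coupling pA w1 -> coupling pA w2 ->
  coupling pA (mixture t w1 w2).
Proof.
move=> [w10 w1A] [w20 w2A]; split=> [[u|u] a|a]/=.
- exact: mulr_ge0.
- by rewrite mulr_ge0// subr_ge0.
- by rewrite big_sumType/= -!mulr_sumr w1A w2A -mulrDl addrC subrK mul1r.
Qed.

Lemma mixture_info :
  info pA (mixture t w1 w2) = t * info pA w1 + (1 - t) * info pA w2.
Proof.
rewrite /info big_sumType/= !mulr_sumr; congr (_ + _); apply: eq_bigr => u _.
  exact: row_infoZ.
by rewrite row_infoZ// subr_ge0.
Qed.

Lemma mixture_info_push :
  info pB (fun u => push k (mixture t w1 w2 u)) =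
  t * info pB (fun u => push k (w1 u)) + (1 - t) * info pB (fun u => push k (w2 u)).
Proof.
rewrite /info big_sumType/= !mulr_sumr; congr (_ + _); apply: eq_bigr => u _.
  by rewrite pushZ row_infoZ.
by rewrite pushZ row_infoZ// subr_ge0.
Qed.
End mixture.

Lemma coupling_const A (pA : A -> R) : is_pmf pA -> coupling pA (fun _ : unit => pA).
Proof. by move=> [p0 _]; split=> // a; rewrite big_const card_unit/= addr0. Qed.

Lemma info_const A (pA : A -> R) : is_pmf pA -> info pA (fun _ : unit => pA) = 0.
Proof.
move=> [p0 p1]; rewrite /info big1// => _ _; rewrite /row_info big1// => a _.
rewrite p1 mul1r; have [->|pn0] := eqVneq (pA a) 0; first by rewrite mul0r.
by rewrite divff// ln1 mulr0.
Qed.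

(* One letter [u0] is removed by moving the weights [1] of the letters along a
   kernel vector of the |A| + 1 linear constraints, oriented so that the objective
   [beta] does not decrease, until the first weight vanishes. *)
Lemma letter_removal U A (w : U -> A -> R) (alpha beta : U -> R) :
  (#|A| + 1 < #|U|)%N -> (forall u a, 0 <= w u a) ->
  (forall u, \sum_a w u a = 0 -> alpha u = 0 /\ beta u = 0) ->
  exists (u0 : U) (c : U -> R),
    [/\ forall u, 0 <= c u, c u0 = 0,
        forall a, \sum_u c u * w u a = \sum_u w u a,
        \sum_u c u * alpha u = \sum_u alpha u
      & \sum_u beta u <= \sum_u c u * beta u].
Proof.
move=> cardU w0 ab0.
have [[u0 u00]|/forallNP mass_n0] := pselect (exists u, \sum_a w u a = 0).
  have wu0 a : w u0 a = 0 by apply: (psumr_eq0P (fun a _ => w0 u0 a) u00).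
  have [alpha0 beta0] := ab0 _ u00.
  have cE (F : U -> R) : F u0 = 0 -> \sum_u (u != u0)%:R * F u = \sum_u F u.
    move=> F0; apply: eq_bigr => u _; have [->|_] := eqVneq u u0; first by rewrite F0 mulr0.
    by rewrite mul1r.
  exists u0, (fun u => (u != u0)%:R); split=> [u||a||]; rewrite ?eqxx ?cE//.
have mass_gt0 u : 0 < \sum_a w u a.
  by rewrite lt_neqAle sumr_ge0// andbT eq_sym; apply/eqP; exact: mass_n0.
pose M : 'M[R]_(#|U|, #|A| + 1) := \matrix_(i, j)
  match fintype.split j with inl a => w (enum_val i) (enum_val a) | inr _ => alpha (enum_val i) end.
have : kermx M != 0.
  rewrite -mxrank_eq0 mxrank_ker -lt0n subn_gt0.
  exact: leq_ltn_trans (rank_leq_col _) cardU.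
move=> /rowV0Pn[v0 /sub_kermxP v0M v0n0].
wlog [v [vn0 vw va vb]] : / exists v : U -> R, [/\ exists u, v u != 0,
    forall a, \sum_u v u * w u a = 0, \sum_u v u * alpha u = 0 & 0 <= \sum_u v u * beta u].
  apply; pose v u := v0 0 (enum_rank u).
  have vE (F : U -> R) : \sum_i v0 0 i * F (enum_val i) = \sum_u v u * F u.
    rewrite [RHS](reindex_onto enum_val enum_rank)/=; last by move=> u _; rewrite enum_rankK.
    apply: eq_big => [i|i _]; first by rewrite enum_valK eqxx.
    by rewrite /v enum_valK.
  have vn0 : exists u, v u != 0.
    have /rV0Pn[i vi] := v0n0.
    by exists (enum_val i); rewrite /v enum_valK.
  have vw a : \sum_u v u * w u a = 0.
    have /rowP/(_ (lshift 1 (enum_rank a))) := v0M; rewrite !mxE => h.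
    rewrite -[RHS]h -(vE (fun u => w u a)); apply: eq_bigr => i _; rewrite !mxE.
    by rewrite (unsplitK (inl _)) enum_rankK.
  have va : \sum_u v u * alpha u = 0.
    have /rowP/(_ (rshift #|A| ord0)) := v0M; rewrite !mxE => h.
    by rewrite -[RHS]h -(vE alpha); apply: eq_bigr => i _; rewrite !mxE (unsplitK (inr _)).
  have [vb|vb] := leP 0 (\sum_u v u * beta u); first by exists v.
  exists (fun u => - v u); split.
  - by case: vn0 => u vu; exists u; rewrite oppr_eq0.
  - by move=> a; under eq_bigr do rewrite mulNr; rewrite sumrN vw oppr0.
  - by under eq_bigr do rewrite mulNr; rewrite sumrN va oppr0.
  - by under eq_bigr do rewrite mulNr; rewrite sumrN oppr_ge0 ltW.
(* Every row has positive mass and the combination of the rows with weights [v] is 0, so [v] takes a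
   negative value. *)
have [u1 u1N] : exists u, v u < 0.
  apply: contrapT => /forallNP vN; case: vn0 => u /eqP; apply.
  have v0' u' : 0 <= v u' by rewrite leNgt; apply/negP/vN.
  have : \sum_u v u * \sum_a w u a = 0.
    under eq_bigr do rewrite mulr_sumr.
    by rewrite exchange_big big1.
  move=> /(psumr_eq0P (fun u _ => mulr_ge0 (v0' u) (ltW (mass_gt0 u)))) /(_ u isT) /eqP.
  by rewrite mulf_eq0 (gt_eqF (mass_gt0 u)) orbF => /eqP.
(* At the most negative coordinate, the weights [1 - v u / v u0] are nonnegative and vanish at [u0];
   since [- (v u0)^-1] is positive, the objective moves in the direction of [v]. *)
pose u0 := [arg min_(u < u1) v u]%O.
have [u0le u0N] : (forall u, v u0 <= v u) /\ v u0 < 0.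
  rewrite /u0; case: arg_minP => // u _ ule; split=> [u'|]; first exact: ule.
  exact: le_lt_trans (ule _ isT) u1N.
have cE (F : U -> R) : \sum_u (1 - v u / v u0) * F u =
    \sum_u F u - (v u0)^-1 * \sum_u v u * F u.
  rewrite mulr_sumr -sumrB; apply: eq_bigr => u _; ring.
exists u0, (fun u => 1 - v u / v u0); split=> [u||a||].
- by rewrite subr_ge0 ler_ndivrMr// mul1r.
- by rewrite divff ?subrr// lt_eqF.
- by rewrite cE vw mulr0 subr0.
- by rewrite cE va mulr0 subr0.
- by rewrite cE lerDl -mulNr mulr_ge0// -invrN invr_ge0 oppr_ge0 ltW.
Qed.

(** By homogeneity of [row_info], both informations are linear in weights put on the letters.
    Preserving the marginal costs [#|A|] linear constraints and preserving the input information one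
    more, so letters can be removed while there are more than [#|A| + 1]. *)
Lemma cardinality_bound U A B (pA : A -> R) (pB : B -> R) (k : A -> B -> R)
    (w : U -> A -> R) :
  channel k -> coupling pA w ->
  exists (U' : finType) (w' : U' -> A -> R),
    [/\ coupling pA w', (#|U'| <= #|A| + 1)%N, info pA w' = info pA w
      & info pB (fun u => push k (w u)) <= info pB (fun u => push k (w' u))].
Proof.
move=> hk; have [n] := ubnP #|U|; elim: n U w => // n IHn U w.
rewrite ltnS => cardU [w0 wA].
have [|cardA] := leqP #|U| (#|A| + 1); first by exists U, w; split.
have [|u0 [c [c0 cu0 cw ca cb]]] := @letter_removal _ _ w
    (fun u => row_info pA (w u)) (fun u => row_info pB (push k (w u))) cardA w0.
  move=> u mu0; split; first exact: row_info_mass0.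
  by apply: row_info_mass0; [exact: push_ge0|rewrite push_mass].
pose U' : finType := {u in predC1 u0}.
pose w' (u : U') a := c (val u) * w (val u) a.
have subE (F : U -> R) : F u0 = 0 -> \sum_(u : U') F (val u) = \sum_u F u.
  by move=> F0; rewrite -big_sub [RHS](bigD1 u0)//= F0 add0r.
have iA : info pA w' = info pA w.
  rewrite /info -ca -subE ?cu0 ?mul0r//.
  by apply: eq_bigr => u _; rewrite row_infoZ.
have iB : info pB (fun u => push k (w u)) <= info pB (fun u => push k (w' u)).
  rewrite /info (le_trans cb)// -subE ?cu0 ?mul0r//.
  by apply: ler_sum => u _; rewrite pushZ row_infoZ.
have cw' : coupling pA w'.
  split=> [u a|a]; first by rewrite mulr_ge0.
  by rewrite (subE (fun u => c u * w u a)) ?cu0 ?mul0r// cw wA.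
have [|U'' [w'' [h1 h2 h3 h4]]] := IHn U' w' _ cw'.
  rewrite card_sig (leq_trans _ cardU)//= (_ : #|_| = #|predC1 u0|); last by apply: eq_card.
  by rewrite cardC1 ltn_predL; apply/card_gt0P; exists u0.
by exists U'', w''; split=> //; [rewrite h3|exact: le_trans h4].
Qed.
End Mixtures.

(** * Memoryless sources and single-letterization *)

Section Powers.
Variable R : realType.
Implicit Types A B U : finType.

Definition iid_pmf A (p : A -> R) n (t : n.-tuple A) : R := \prod_(i < n) p (tnth t i).

Definition memoryless A B (k : A -> B -> R) n (t : n.-tuple A) (s : n.-tuple B) : R :=
  \prod_(i < n) k (tnth t i) (tnth s i).

Lemma sum_tuple0 A (F : 0.-tuple A -> R) : \sum_t F t = F [tuple].
Proof.
rewrite (bigD1 [tuple])//= big1 ?addr0// => t /eqP[]; exact: tuple0.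
Qed.

Lemma sum_tupleS A n (F : n.+1.-tuple A -> R) :
  \sum_t F t = \sum_x \sum_(t : n.-tuple A) F [tuple of x :: t].
Proof.
rewrite pair_bigA (reindex (fun p : A * n.-tuple A => [tuple of p.1 :: p.2]))//.
exists (fun t => (thead t, [tuple of behead t])) => [[x t] _|t _]/=.
  by rewrite theadE; congr (_, _); apply: val_inj.
by rewrite [RHS]tuple_eta; apply: val_inj.
Qed.

Lemma iid_pmf_cons A (p : A -> R) n x (t : n.-tuple A) :
  iid_pmf p [tuple of x :: t] = p x * iid_pmf p t.
Proof.
by rewrite /iid_pmf big_ord_recl tnth0; congr (_ * _); apply: eq_bigr => i _; rewrite tnthS.
Qed.

Lemma memoryless_cons A B (k : A -> B -> R) n x y (t : n.-tuple A) (s : n.-tuple B) :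
  memoryless k [tuple of x :: t] [tuple of y :: s] = k x y * memoryless k t s.
Proof.
by rewrite /memoryless big_ord_recl !tnth0; congr (_ * _); apply: eq_bigr => i _; rewrite !tnthS.
Qed.

Lemma sum_tuple_prod A n (F : 'I_n -> A -> R) :
  \sum_(t : n.-tuple A) \prod_(i < n) F i (tnth t i) = \prod_(i < n) \sum_x F i x.
Proof.
elim: n F => [|n IHn] F; first by rewrite sum_tuple0 !big_ord0.
rewrite sum_tupleS big_ord_recl -IHn mulr_suml; apply: eq_bigr => x _.
rewrite mulr_sumr; apply: eq_bigr => t _; rewrite big_ord_recl tnth0.
by congr (_ * _); apply: eq_bigr => i _; rewrite tnthS.
Qed.

Lemma iid_pmf_ge0 A (p : A -> R) n (t : n.-tuple A) : (forall a, 0 <= p a) -> 0 <= iid_pmf p t.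
Proof. by move=> p0; apply: prodr_ge0. Qed.

Lemma is_pmf_iid A (p : A -> R) n : is_pmf p -> is_pmf (@iid_pmf A p n).
Proof.
move=> [p0 p1]; split=> [t|]; first exact: iid_pmf_ge0.
by rewrite (sum_tuple_prod (fun _ => p)) big1.
Qed.

Lemma channel_memoryless A B (k : A -> B -> R) n : channel k -> channel (@memoryless A B k n).
Proof.
move=> [k0 k1]; split=> [t s|t]; first exact: prodr_ge0.
by rewrite (sum_tuple_prod (fun i => k (tnth t i))) big1.
Qed.

Lemma push_memoryless A B (k : A -> B -> R) (p : A -> R) n :
  push (@memoryless A B k n) (@iid_pmf A p n) = @iid_pmf B (push k p) n.
Proof.
apply/funext => s; rewrite /push /iid_pmf -(sum_tuple_prod (fun i a => p a * k a (tnth s i))).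
by apply: eq_bigr => t _; rewrite -big_split.
Qed.

Lemma row_info_tupleS A (p : A -> R) n (m : n.+1.-tuple A -> R) :
  row_info (@iid_pmf A p n.+1) m =
  row_info (fun ab => p ab.1 * iid_pmf p ab.2) (fun ab => m [tuple of ab.1 :: ab.2]).
Proof.
rewrite /row_info [LHS]sum_tupleS [RHS]sum_pair; apply: eq_bigr => x _; apply: eq_bigr => t _ /=.
by rewrite iid_pmf_cons sum_tupleS [in RHS]sum_pair.
Qed.

Lemma push_tupleS A B (k : A -> B -> R) n (m : n.+1.-tuple A -> R) y (s : n.-tuple B) :
  push (@memoryless A B k n.+1) m [tuple of y :: s] =
  push (fun ab ab' => k ab.1 ab'.1 * @memoryless A B k n ab.2 ab'.2)
    (fun ab => m [tuple of ab.1 :: ab.2]) (y, s).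
Proof.
rewrite /push [LHS]sum_tupleS [RHS]sum_pair; apply: eq_bigr => x _; apply: eq_bigr => t _ /=.
by rewrite memoryless_cons.
Qed.

(* Each step of the induction splits off one letter by the chain rule and merges the
   two auxiliary variables into one by time sharing. *)
Lemma single_letter A B (p : A -> R) (k : A -> B -> R) n U (w : U -> n.-tuple A -> R) :
  is_pmf p -> channel k -> coupling (@iid_pmf A p n) w ->
  exists (U' : finType) (w' : U' -> A -> R),
    [/\ coupling p w', info (@iid_pmf A p n) w = n%:R * info p w'
      & info (@iid_pmf B (push k p) n) (fun u => push (@memoryless A B k n) (w u))
          <= n%:R * info (push k p) (fun u => push k (w' u))].
Proof.
move=> hp hk; elim: n U w => [|n IHn] U w cw.
  have i0 (C : finType) (q : C -> R) (m : 0.-tuple C -> R) : row_info (@iid_pmf C q 0) m = 0.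
    rewrite /row_info sum_tuple0 sum_tuple0 /iid_pmf big_ord0 mulr1.
    have [->|mn0] := eqVneq (m [tuple]) 0; first by rewrite mul0r.
    by rewrite divff// ln1 mulr0.
  exists unit, (fun _ => p); split; first exact: coupling_const.
    by rewrite /info mul0r big1.
  by rewrite /info mul0r big1.
pose v u (ab : A * n.-tuple A) := w u [tuple of ab.1 :: ab.2].
have cv : coupling (fun ab => p ab.1 * @iid_pmf A p n ab.2) v.
  split=> [u ab|[x t]]; first exact: cw.1.
  by rewrite cw.2 iid_pmf_cons.
have [p0 p1] := hp; have [pn0 pn1] := is_pmf_iid n hp.
have [U1 [w1 [c1 i1 j1]]] := IHn _ _ (coupling_rest cv p1).
pose w2 (ub : U * n.-tuple A) a := v ub.1 (a, ub.2).
have c2 : coupling p w2 := coupling_letter cv pn1.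
have n1 : 0 < n.+1%:R :> R by rewrite ltr0n.
(* With this weight, [n + 1] times an information of the mixture is [n] times that of [w1] plus that
   of [w2]. *)
pose t : R := n%:R / n.+1%:R.
have t0 : 0 <= t by rewrite divr_ge0.
have t1 : t <= 1 by rewrite ler_pdivrMr// mul1r ler_nat.
have tn : n.+1%:R * t = n%:R by rewrite mulrC divfK// gt_eqF.
have tn' : n.+1%:R * (1 - t) = 1 by rewrite mulrBr tn mulr1 -natr1 addrAC subrr add0r.
clearbody t; exists (U1 + (U * n.-tuple A))%type, (mixture t w1 w2); split.
- exact: mixture_coupling.
- rewrite mixture_info// mulrDr !mulrA tn tn' mul1r -i1 -(info_chain cv)//.
  by apply: eq_bigr => u _; rewrite row_info_tupleS.
- rewrite mixture_info_push// mulrDr !mulrA tn tn' mul1r.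
  apply: (@le_trans _ _ (info (@iid_pmf B (push k p) n)
      (fun u => push (@memoryless A B k n) (fun b => \sum_a v u (a, b))) +
      info (push k p) (fun ub => push k (w2 ub)))); last by rewrite lerD2r.
  have := info_push_chain cv hp (is_pmf_iid n hp) hk (channel_memoryless n hk).
  rewrite push_memoryless; apply: le_trans; rewrite le_eqVlt; apply/orP; left; apply/eqP.
  apply: eq_bigr => u _; rewrite row_info_tupleS; congr row_info.
  by apply/funext => -[y s]; rewrite push_tupleS.
Qed.

(** For a deterministic encoder the information is the entropy of the message, whose defect from
    [ln M] is the divergence from the uniform law. *)
Lemma info_code_le A (p : A -> R) M (f : A -> 'I_M) : is_pmf p ->
  info p (fun m a => (f a == m)%:R * p a) <= ln M%:R.
Proof.
move=> [p0 p1]; have M0 : (0 < M)%N.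
  case: M f => // f; exfalso.
  suff : (\sum_a p a) = 0 by move/eqP; rewrite p1 oner_eq0.
  by apply: big1 => a _; case: (f a).
pose mu m := \sum_a (f a == m)%:R * p a.
have mu0 m : 0 <= mu m by apply: sumr_ge0 => a _; rewrite mulr_ge0.
have mu1 : \sum_m mu m = 1.
  rewrite exchange_big/= -[RHS]p1; apply: eq_bigr => a _.
  rewrite -mulr_suml (bigD1 (f a))//= eqxx big1 ?addr0 ?mul1r// => m.
  by rewrite eq_sym => /negbTE ->.
have M0r : 0 < M%:R^-1 :> R by rewrite invr_gt0 ltr0n.
have row m : row_info p (fun a => (f a == m)%:R * p a) = - (mu m * ln (mu m)).
  rewrite -mulrN mulr_suml; apply: eq_bigr => a _.
  case: eqP => [fa|_]; last by rewrite !mul0r.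
  rewrite !mul1r; have [->|pn0] := eqVneq (p a) 0; first by rewrite !mul0r.
  have p_gt0 : 0 < p a by rewrite lt_neqAle eq_sym pn0 p0.
  have mu_gt0 : 0 < mu m.
    rewrite /mu (bigD1 a)//= fa eqxx mul1r ltr_pwDl// sumr_ge0// => ? _; exact: mulr_ge0.
  by rewrite invfM mulrCA mulfV ?mulr1 ?lnV.
rewrite /info (eq_bigr _ (fun m _ => row m)) sumrN lerNl.
have : \sum_m (mu m * 0 + mu m - M%:R^-1 * expR 0) <= \sum_m mu m * ln (mu m / M%:R^-1).
  apply: ler_sum => m _; apply: mul_ln_div_ge => //.
  by move=> e; rewrite e ltxx in M0r.
under eq_bigr do rewrite mulr0 add0r expR0 mulr1.
rewrite sumrB mu1 sumr_const card_ord -[_^-1 *+ _]mulr_natr mulVf ?gt_eqF ?ltr0n// subrr.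
suff -> : \sum_m mu m * ln (mu m / M%:R^-1) = \sum_m mu m * ln (mu m) + ln M%:R.
  by rewrite -lerBlDr sub0r.
have -> : ln M%:R = \sum_m mu m * ln M%:R :> R by rewrite -mulr_suml mu1 mul1r.
rewrite -big_split; apply: eq_bigr => m _ /=.
have [->|mun0] := eqVneq (mu m) 0; first by rewrite !mul0r addr0.
have mu_gt0 : 0 < mu m by rewrite lt_neqAle eq_sym mun0 mu0.
by rewrite invrK lnM ?posrE ?ltr0n// mulrDr.
Qed.
End Powers.

(** * The functions xi and D *)

Section Model.
Variables (R : realType) (X Y : finType) (P : X * Y -> R).
Implicit Types U : finType.

(* Inputs of mass [0] get the output law [snd_marg P], so that the rows are stochastic
   and comparable to the output law without exception. *)
Definition transition (x : X) (y : Y) : R :=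
  if fst_marg P x == 0 then snd_marg P y else P (x, y) / fst_marg P x.

Lemma mutual_info_info U (A : finType) (w : U * A -> R) (pA : A -> R) : snd_marg w =1 pA ->
  mutual_info w = info pA (fun u a => w (u, a)) / ln 2.
Proof.
move=> wA; rewrite /mutual_info /divergence sum_pair /info mulr_suml.
apply: eq_bigr => u _; rewrite mulr_suml; apply: eq_bigr => a _.
by rewrite /prod_marg/= wA /log2 mulrA.
Qed.

Hypothesis hP : is_pmf P.

Lemma fst_marg_pmf : is_pmf (fst_marg P).
Proof.
case: hP => P0 P1; split=> [x|]; first exact: sumr_ge0.
by rewrite -P1 sum_pair.
Qed.

Lemma snd_marg_pmf : is_pmf (snd_marg P).
Proof.
case: hP => P0 P1; split=> [y|]; first exact: sumr_ge0.
by rewrite -P1 sum_pair exchange_big.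
Qed.

Lemma fst_marg_eq0 x y : fst_marg P x = 0 -> P (x, y) = 0.
Proof.
by case: hP => P0 _ Px0; apply: (psumr_eq0P (fun y _ => P0 (x, y)) Px0).
Qed.

Lemma snd_marg_eq0 x y : snd_marg P y = 0 -> P (x, y) = 0.
Proof.
by case: hP => P0 _ Py0; apply: (psumr_eq0P (fun x _ => P0 (x, y)) Py0).
Qed.

Lemma transitionE x y : fst_marg P x * transition x y = P (x, y).
Proof.
rewrite /transition; have [Px0|Px0] := eqVneq; first by rewrite Px0 mul0r fst_marg_eq0.
by rewrite mulrC divfK.
Qed.

Lemma transition_channel : channel transition.
Proof.
have [P0 _] := hP; have [PX0 _] := fst_marg_pmf; have [PY0 PY1] := snd_marg_pmf.
split=> [x y|x]; rewrite /transition; case: eqVneq => // Px0; first exact: divr_ge0.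
by rewrite -mulr_suml mulfV.
Qed.

Lemma push_transition : push transition (fst_marg P) = snd_marg P.
Proof. by apply/funext => y; apply: eq_bigr => x _; rewrite transitionE. Qed.

Lemma iid_lawE n (xy : n.-tuple X * n.-tuple Y) :
  iid_law P xy = iid_pmf (fst_marg P) xy.1 * memoryless transition xy.1 xy.2.
Proof. by rewrite -big_split; apply: eq_bigr => i _ /=; rewrite transitionE. Qed.

Lemma iid_prod_margE n (xy : n.-tuple X * n.-tuple Y) :
  iid_law (prod_marg P) xy = iid_pmf (fst_marg P) xy.1 * iid_pmf (snd_marg P) xy.2.
Proof. by rewrite -big_split. Qed.

Lemma ln2_gt0 : 0 < ln (2 : R).
Proof. by rewrite ln_gt0// ltr1n. Qed.

(** * Correspondence between admissible laws and couplings of the input *)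

Section coupling_admissible.
Variables (U : finType) (w : U -> X -> R) (r : R).
Hypotheses (cw : coupling (fst_marg P) w) (cardU : (#|U| <= #|X| + 1)%N).
Hypothesis wr : info (fst_marg P) w / ln 2 <= r.

Let W (uxy : U * X * Y) : R := w uxy.1.1 uxy.1.2 * transition uxy.1.2 uxy.2.

Lemma coupling_admissible : admissible P W r.
Proof.
have [w0 wX] := cw; have [V0 V1] := transition_channel; have [PX0 PX1] := fst_marg_pmf.
have UX u x : law_UX W (u, x) = w u x by rewrite /law_UX /W/= -mulr_sumr V1 mulr1.
have XY : law_XY W =1 P.
  by move=> [x y]; rewrite /law_XY /W/= -mulr_suml wX transitionE.
have LX x : law_X W x = fst_marg P x.
  by rewrite -wX; apply: eq_bigr => u _; rewrite -UX.
split=> //.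
- split=> [uxy|]; first exact: mulr_ge0.
  rewrite !sum_pair -PX1 exchange_big; apply: eq_bigr => x _ /=.
  by rewrite -wX; apply: eq_bigr => u _; rewrite /W/= -mulr_sumr V1 mulr1.
- move=> u x y; rewrite LX UX XY /W/= => Px0.
  by rewrite /transition (negbTE Px0); ring.
- rewrite (@mutual_info_info _ _ _ (fst_marg P)); last first.
    by move=> x; rewrite -wX; apply: eq_bigr => u _; rewrite UX.
  by rewrite (_ : (fun u a => _) = w)//; apply/funext => u; apply/funext => x; rewrite UX.
Qed.

Lemma coupling_output_info :
  mutual_info (law_UY W) = info (snd_marg P) (fun u => push transition (w u)) / ln 2.
Proof.
apply: mutual_info_info => y.
by rewrite -push_transition -(coupling_push transition_channel cw).2.
Qed.
End coupling_admissible.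

Section admissible_coupling.
Variables (U : finType) (W : U * X * Y -> R) (r : R).
Hypothesis hW : admissible P W r.

Let w u x := law_UX W (u, x).

Lemma admissible_coupling : coupling (fst_marg P) w.
Proof.
case: hW => -[W0 _] XY _ _ _; split=> [u x|x]; first exact: sumr_ge0.
by rewrite exchange_big; apply: eq_bigr => y _; rewrite -XY.
Qed.

(** Where [fst_marg P x] is 0 the Markov condition says nothing and [transition] takes its default
    value, but the joint mass of [u] and [x] vanishes there as well. *)
Lemma admissible_law_UY u y : law_UY W (u, y) = push transition (w u) y.
Proof.
case: hW => -[W0 _] XY mW _ _; apply: eq_bigr => x _ /=.
have LX : law_X W x = fst_marg P x by rewrite -admissible_coupling.2.
have [Px0|Px0] := eqVneq (fst_marg P x) 0.
  have w0 : w u x = 0.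
    apply: le_anti; rewrite -{1}Px0 (coupling_le_col _ _ admissible_coupling).
    exact: admissible_coupling.1.
  by rewrite w0 mul0r; apply: (psumr_eq0P (fun y _ => W0 (u, x, y)) w0).
have := mW u x y; rewrite LX XY => /(_ Px0) /(congr1 (fun t => t * fst_marg P x)).
rewrite divfK// => ->; rewrite /transition (negbTE Px0) -/(w u x).
by field.
Qed.

Lemma admissible_input_info : info (fst_marg P) w / ln 2 <= r.
Proof.
case: (hW) => _ _ _ + _; rewrite (@mutual_info_info _ _ _ (fst_marg P))//.
exact: admissible_coupling.2.
Qed.

Lemma admissible_output_info :
  mutual_info (law_UY W) = info (snd_marg P) (fun u => push transition (w u)) / ln 2.
Proof.
rewrite (@mutual_info_info _ _ _ (snd_marg P)).
  by congr (info _ _ / _); apply/funext => u; apply/funext => y; rewrite admissible_law_UY.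
move=> y; rewrite -push_transition -(coupling_push transition_channel admissible_coupling).2.
by apply: eq_bigr => u _; rewrite admissible_law_UY.
Qed.
End admissible_coupling.

Hypothesis hC : (llr_bound P < +oo)%E.

(** The supremum is over a nonempty set of nonnegative values, so it is not [-oo], and [fine] loses
    nothing. *)
Lemma llr_boundE : exists2 c : R, 0 <= c & llr_bound P = c%:E.
Proof.
have [x [y Qxy]] : exists x y, prod_marg P (x, y) != 0.
  apply: contrapT => /forallNP h.
  have : \sum_x fst_marg P x * \sum_y snd_marg P y = 0.
    rewrite big1// => x _; rewrite mulr_sumr big1// => y _.
    by have /forallNP/(_ y)/negP := h x; rewrite negbK => /eqP.
  rewrite snd_marg_pmf.2; under eq_bigr do rewrite mulr1.
  by rewrite fst_marg_pmf.2 => /eqP; rewrite oner_eq0.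
have : (0 <= llr_bound P)%E.
  apply: (@le_trans _ _ `|lne (P (x, y) / prod_marg P (x, y))%:E * ((ln 2)^-1)%:E|%E) => //.
  by apply: ereal_sup_ubound; exists (x, y).
by move: hC; case: llr_bound => // c _ c0; exists c.
Qed.

Lemma llr_bound_ge0 : 0 <= fine (llr_bound P).
Proof. by have [c c0 ->] := llr_boundE. Qed.

Let c := fine (llr_bound P) * ln 2.

Lemma transition_bounds x y :
  expR (- c) * snd_marg P y <= transition x y <= expR c * snd_marg P y.
Proof.
have c0 : 0 <= c by rewrite mulr_ge0 ?llr_bound_ge0// ltW// ln2_gt0.
have [P0 _] := hP; have [PX0 _] := fst_marg_pmf; have [PY0 _] := snd_marg_pmf.
rewrite /transition; have [Px0|Px0] := eqVneq.
  rewrite -{2}[snd_marg P y]mul1r -{3}[snd_marg P y]mul1r !ler_wpM2r// -expR0 ler_expR//.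
  by rewrite oppr_le0.
have [Py0|Py0] := eqVneq (snd_marg P y) 0.
  by rewrite Py0 !mulr0 snd_marg_eq0// mul0r lexx.
have Px : 0 < fst_marg P x by rewrite lt_neqAle eq_sym Px0 PX0.
have Py : 0 < snd_marg P y by rewrite lt_neqAle eq_sym Py0 PY0.
have Q0 : 0 < prod_marg P (x, y) by rewrite mulr_gt0.
have : (`|lne (P (x, y) / prod_marg P (x, y))%:E * ((ln 2)^-1)%:E| <= llr_bound P)%E.
  by apply: ereal_sup_ubound; exists (x, y) => //=; rewrite gt_eqF.
have [c' c'0 cE] := llr_boundE; rewrite cE.
have cc' : c = c' * ln 2 by rewrite /c cE.
have l2 : 0 < (ln 2)^-1 :> R by rewrite invr_gt0 ln2_gt0.
(* A zero of [P] where the product law is positive would put [+oo] in the supremum. *)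
have [Pn0|Pn0] := leP (P (x, y)) 0.
  rewrite le0_lneNy; last by rewrite lee_fin mulr_le0_ge0// invr_ge0 ltW.
  by rewrite gt0_mulNye.
have rat0 : 0 < P (x, y) / prod_marg P (x, y) by rewrite divr_gt0.
rewrite lne_EFin// -EFinM abse_EFin lee_fin ler_norml.
rewrite ler_pdivlMr ?ln2_gt0// ler_pdivrMr ?ln2_gt0// mulNr -cc' => /andP[h1 h2].
rewrite -ler_expR lnK// ler_pdivlMr// in h1.
rewrite -ler_expR lnK// ler_pdivrMr// in h2.
rewrite ler_pdivlMr// ler_pdivrMr// -!mulrA [snd_marg P y * _]mulrC.
by apply/andP.
Qed.

Lemma push_transition_bounds (m : X -> R) y : (forall x, 0 <= m x) ->
  expR (- c) * ((\sum_x m x) * snd_marg P y) <= push transition m y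
    <= expR c * ((\sum_x m x) * snd_marg P y).
Proof.
move=> m0; apply/andP; split; rewrite mulrCA mulr_suml; apply: ler_sum => x _;
  by rewrite ler_wpM2l//; have /andP[] := transition_bounds x y.
Qed.

Lemma output_density_bound (m : X -> R) y : (forall x, 0 <= m x) ->
  0 < push transition m y ->
  `|ln (push transition m y / ((\sum_x m x) * snd_marg P y))| <= c.
Proof.
move=> m0 J0; have /andP[lb ub] := push_transition_bounds y m0.
have Q0 : 0 < (\sum_x m x) * snd_marg P y.
  by have := lt_le_trans J0 ub; rewrite pmulr_rgt0// expR_gt0.
rewrite ler_norml -ler_expR -[X in _ && X]ler_expR lnK ?posrE ?divr_gt0//.
by rewrite ler_pdivlMr// ler_pdivrMr// lb.
Qed.

Lemma output_info_le U (w : U -> X -> R) : coupling (fst_marg P) w ->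
  info (snd_marg P) (fun u => push transition (w u)) <= c.
Proof.
move=> cw; have cV := coupling_push transition_channel cw.
have -> : c = \sum_u \sum_y push transition (w u) y * c.
  under eq_bigr do rewrite -mulr_suml; rewrite -mulr_suml (coupling_mass cV).
  by rewrite push_transition snd_marg_pmf.2 mul1r.
apply: ler_sum => u _; apply: ler_sum => y _.
have [->|J0] := eqVneq (push transition (w u) y) 0; first by rewrite !mul0r.
have {}J0 : 0 < push transition (w u) y by rewrite lt_neqAle eq_sym J0 cV.1.
rewrite ler_wpM2l ?(ltW J0)// (push_mass _ transition_channel).
exact: le_trans (ler_norm _) (output_density_bound (cw.1 u) J0).
Qed.

Lemma xi_set_nonempty r : 0 <= r ->
  exists (U : finType) (W : U * X * Y -> R), admissible P W r.
Proof.
move=> r0; exists unit; have cP := coupling_const fst_marg_pmf.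
eexists; apply: (coupling_admissible cP).
  by rewrite card_unit addn1.
by rewrite info_const ?mul0r//; exact: fst_marg_pmf.
Qed.

Lemma xi_has_sup r : 0 <= r ->
  has_sup [set t | exists (U : finType) (W : U * X * Y -> R),
    admissible P W r /\ t = mutual_info (law_UY W)].
Proof.
move=> r0; split.
  have [U [W hW]] := xi_set_nonempty r0.
  by exists (mutual_info (law_UY W)), U, W.
exists (fine (llr_bound P)) => _ [U [W [hW ->]]].
rewrite (admissible_output_info hW) ler_pdivrMr ?ln2_gt0//.
exact: output_info_le (admissible_coupling hW).
Qed.

(** The auxiliary alphabet is arbitrary here: the constraint on its size in [xi] is met through
    [cardinality_bound]. *)
Lemma xi_ge U (w : U -> X -> R) r : 0 <= r ->
  coupling (fst_marg P) w -> info (fst_marg P) w / ln 2 <= r ->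
  info (snd_marg P) (fun u => push transition (w u)) / ln 2 <= xi P r.
Proof.
move=> r0 cw wr.
have [U' [w' [cw' cardU' i' j']]] :=
  cardinality_bound (snd_marg P) transition_channel cw.
apply: (@le_trans _ _ (info (snd_marg P) (fun u => push transition (w' u)) / ln 2)).
  by rewrite ler_pM2r// invr_gt0 ln2_gt0.
apply: ub_le_sup; first exact: (xi_has_sup r0).2.
exists U'; eexists; split; last exact: esym (coupling_output_info cw').
by apply: coupling_admissible; rewrite ?i'.
Qed.

Lemma xi_approx r eta : 0 <= r -> 0 < eta ->
  exists (U : finType) (w : U -> X -> R),
    [/\ coupling (fst_marg P) w, info (fst_marg P) w / ln 2 <= r &
      xi P r - eta < info (snd_marg P) (fun u => push transition (w u)) / ln 2].
Proof.
move=> r0 eta0; have [_ [U [W [hW ->]]] h] := sup_adherent eta0 (xi_has_sup r0).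
exists U, (fun u x => law_UX W (u, x)); split.
- exact: admissible_coupling hW.
- exact: admissible_input_info hW.
- by rewrite -(admissible_output_info hW).
Qed.

Lemma xi_ge0 r : 0 <= r -> 0 <= xi P r.
Proof.
move=> r0; have cP := coupling_const fst_marg_pmf.
apply: le_trans (xi_ge r0 cP _); last by rewrite info_const ?mul0r//; exact: fst_marg_pmf.
apply: divr_ge0; last exact: ltW ln2_gt0.
apply: info_ge0 snd_marg_pmf.2.
by rewrite -push_transition; exact: coupling_push transition_channel cP.
Qed.

Lemma xi_le r : 0 <= r -> xi P r <= fine (llr_bound P).
Proof.
move=> r0; apply: ge_sup; first exact: (xi_has_sup r0).1.
move=> _ [U [W [hW ->]]]; rewrite (admissible_output_info hW) ler_pdivrMr ?ln2_gt0//.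
exact: output_info_le (admissible_coupling hW).
Qed.

Lemma cond_entropy_ge0 (A B : finType) (p : A * B -> R) : (forall ab, 0 <= p ab) ->
  0 <= cond_entropy p.
Proof.
move=> p0; rewrite /cond_entropy -sumrN; apply: sumr_ge0 => -[a b] _.
rewrite /log2 -mulrN mulr_ge0// -mulNr divr_ge0 ?(ltW ln2_gt0)//.
rewrite oppr_ge0 ln_le0//=; have pf : p (a, b) <= fst_marg p a.
  by rewrite /fst_marg (bigD1 b)//= lerDl sumr_ge0.
have [->|f0] := eqVneq (fst_marg p a) 0; first by rewrite invr0 mulr0.
by rewrite ler_pdivrMr ?mul1r// lt_neqAle eq_sym f0 (le_trans _ pf).
Qed.

Lemma noisy_dist_rate_nonincreasing r s : 0 <= r -> r <= s ->
  noisy_dist_rate P s <= noisy_dist_rate P r.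
Proof.
move=> r0 rs; apply: lb_le_inf.
  have [U [W hW]] := xi_set_nonempty r0.
  by exists (cond_entropy (law_UY W)), U, W.
move=> _ [U [W [[pW XY mW Wr cU] ->]]]; apply: ge_inf.
  exists 0 => _ [U' [W' [[[W'0 _] _ _ _ _] ->]]].
  by apply: cond_entropy_ge0 => uy; apply: sumr_ge0.
by exists U, W; split=> //; split=> //; exact: le_trans rs.
Qed.

(* The library sets the derivative to [0] where the limit does not exist. *)
Lemma derive1_noisy_dist_rate_le0 r : 0 < r -> derive1 (noisy_dist_rate P) r <= 0.
Proof.
move=> r0; rewrite derive1E /derive.
set F := (X in lim X); have [cF|/dvgP->//] := pselect (cvg F).
apply: limr_le => //.
near=> h; have hr : `|h| < r by near: h; exact: dnbhs0_lt.
rewrite /= scaler1; have [h0|h0|->] := ltgtP h 0; last by rewrite invr0 scale0r.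
  rewrite nmulr_rle0 ?invr_lt0// subr_ge0 noisy_dist_rate_nonincreasing//.
    by rewrite ltr0_norm// in hr; lra.
  by rewrite gerDr ltW.
rewrite pmulr_rle0 ?invr_gt0// subr_le0 noisy_dist_rate_nonincreasing ?(ltW r0)//.
by rewrite lerDr ltW.
Unshelve. all: end_near. Qed.

End Model.

(** * Converse *)

Section Converse.
Variable R : realType.

Lemma code_sum (A B : finType) M (f : A -> 'I_M) (p : A -> R) (k : A -> B -> R)
    (G : 'I_M -> B -> R) :
  \sum_m \sum_b (\sum_a (f a == m)%:R * p a * k a b) * G m b =
  \sum_a \sum_b p a * k a b * G (f a) b.
Proof.
under eq_bigr do under eq_bigr do rewrite mulr_suml.
under eq_bigr do rewrite exchange_big.
rewrite exchange_big; apply: eq_bigr => a _.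
rewrite (bigD1 (f a))//= [X in _ + X]big1 ?addr0.
  by apply: eq_bigr => b _; rewrite eqxx mul1r.
by move=> m fam; rewrite big1// => b _; rewrite eq_sym (negbTE fam) !mul0r.
Qed.

Variables (X Y : finType) (P : X * Y -> R).
Hypothesis hP : is_pmf P.
Hypothesis hC : (llr_bound P < +oo)%E.

Lemma two_powR (x : R) : 2 `^ x = expR (x * ln 2).
Proof. by rewrite /powR (gt_eqF (@ltr0Sn R 1)). Qed.

Lemma nb_messages_gt0 n (r : R) : 0 <= r -> (0 < nb_messages n r)%N.
Proof.
move=> r0; rewrite truncn_gt0 two_powR -[leLHS]expR0 ler_expR.
by rewrite !mulr_ge0// ltW// ln2_gt0.
Qed.

Lemma ln_nb_messages n (r : R) : 0 <= r -> ln (nb_messages n r)%:R <= n%:R * r * ln 2.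
Proof.
move=> r0; have M0 := nb_messages_gt0 n r0.
rewrite -ler_expR lnK ?posrE ?ltr0n// -two_powR.
by rewrite truncn_le ?powR_ge0.
Qed.

Section code.
Variables (n : nat) (r : R) (f : encoder X n r) (phi : detector Y n r).
Hypotheses (n0 : (0 < n)%N) (r0 : 0 <= r).

Let PXn := @iid_pmf R X (fst_marg P) n.
Let PYn := @iid_pmf R Y (snd_marg P) n.
Let Vn := @memoryless R X Y (transition P) n.
Let w m t := (f t == m)%:R * PXn t.

Lemma code_coupling : coupling PXn w.
Proof.
have [p0 _] := is_pmf_iid n (fst_marg_pmf hP).
split=> [m t|t]; first by rewrite mulr_ge0// p0.
rewrite (bigD1 (f t))//= big1 ?addr0 /w ?eqxx ?mul1r// => m /negbTE.
by rewrite eq_sym => ->; rewrite mul0r.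
Qed.

(** The message carries at most [ln M <= n r ln 2] nats about the input block, so the single-letter
    law extracted from the code satisfies the rate constraint of [xi]. *)
Lemma code_output_info_le :
  info PYn (fun m => push Vn (w m)) <= n%:R * xi P r * ln 2.
Proof.
have hV := transition_channel hP; have pX := fst_marg_pmf hP.
have [U [v [cv iv jv]]] := single_letter pX hV code_coupling.
rewrite push_transition// in jv.
apply: le_trans jv _; rewrite -mulrA ler_wpM2l// -ler_pdivrMr ?ln2_gt0//.
apply: xi_ge => //; rewrite ler_pdivrMr ?ln2_gt0//.
have nR0 : 0 < n%:R :> R by rewrite ltr0n.
rewrite -(ler_pM2l nR0) -iv mulrA; apply: le_trans (ln_nb_messages n r0).
exact: info_code_le (is_pmf_iid n pX).
Qed.

Lemma err0E : 1 - err0 P f phi =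
  \sum_t \sum_s PXn t * Vn t s * (phi (f t, s) == false)%:R.
Proof.
have iid1 : \sum_(xy : n.-tuple X * n.-tuple Y) iid_law P xy = 1.
  rewrite sum_pair; under eq_bigr do under eq_bigr do rewrite iid_lawE//=.
  under eq_bigr do rewrite -mulr_sumr (channel_memoryless n (transition_channel hP)).2 mulr1.
  exact: (is_pmf_iid n (fst_marg_pmf hP)).2.
have -> : 1 - err0 P f phi = \sum_(xy in accept f phi) iid_law P xy.
  rewrite -iid1 (bigID (mem (accept f phi)))/= /err0.
  by under [X in _ - X]eq_bigl do rewrite inE; rewrite addrK.
rewrite big_mkcond sum_pair; apply: eq_bigr => t _; apply: eq_bigr => s _.
by rewrite inE/= iid_lawE//; case: eqP; rewrite ?mulr1 ?mulr0.
Qed.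

Lemma err1E : err1 P f phi =
  \sum_t \sum_s PXn t * PYn s * (phi (f t, s) == false)%:R.
Proof.
rewrite /err1 big_mkcond sum_pair; apply: eq_bigr => t _; apply: eq_bigr => s _.
by rewrite inE/= iid_prod_margE; case: eqP; rewrite ?mulr1 ?mulr0.
Qed.

(** This is [info_ge] for the test function equal to [L] on accepted pairs and to 0 elsewhere, whose
    exponential has product-law mean at most [1 + expR L * err1 P f phi]. *)
Lemma data_processing (L : R) :
  (1 - err0 P f phi) * L - expR L * err1 P f phi <= n%:R * xi P r * ln 2.
Proof.
have hVn := channel_memoryless n (transition_channel hP).
have [pX0 pX1] := is_pmf_iid n (fst_marg_pmf hP).
have [pY0 pY1] := is_pmf_iid n (snd_marg_pmf hP).
have cV := coupling_push hVn code_coupling.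
have pVn : push Vn PXn = PYn by rewrite push_memoryless push_transition.
rewrite pVn in cV.
pose g m s : R := if phi (m, s) == false then L else 0.
apply: le_trans code_output_info_le; apply: le_trans (info_ge g cV pY1).
have -> : \sum_m \sum_s push Vn (w m) s * g m s = (1 - err0 P f phi) * L.
  rewrite code_sum err0E mulr_suml; apply: eq_bigr => t _; rewrite mulr_suml.
  apply: eq_bigr => s _; rewrite -[RHS]mulrA; congr (_ * _).
  by rewrite /g; case: eqP; rewrite ?mul1r ?mul0r.
have -> : \sum_m \sum_s (\sum_s' push Vn (w m) s') * PYn s * expR (g m s) =
    \sum_t \sum_s PXn t * PYn s * expR (g (f t) s).
  rewrite -(code_sum f PXn (fun _ => PYn) (fun m s => expR (g m s))).
  apply: eq_bigr => m _; apply: eq_bigr => s _.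
  by rewrite push_mass// -mulr_suml.
have : \sum_t \sum_s PXn t * PYn s * expR (g (f t) s) <=
    \sum_t \sum_s (PXn t * PYn s + expR L * (PXn t * PYn s * (phi (f t, s) == false)%:R)).
  apply: ler_sum => t _; apply: ler_sum => s _; have q0 := mulr_ge0 (pX0 t) (pY0 s).
  rewrite /g; case: eqP => _; last by rewrite expR0 !mulr0 addr0 mulr1.
  by rewrite mulr1 mulrC lerDr.
under [X in _ <= X]eq_bigr do rewrite big_split/= -!mulr_sumr pY1 mulr1.
rewrite big_split/= pX1 -mulr_sumr -err1E; lra.
Qed.
End code.

Lemma beta_set_nonempty n (eps r : R) : 0 <= r -> 0 <= eps ->
  [set b | exists (f : encoder X n r) (phi : detector Y n r),
     err0 P f phi <= eps /\ b = err1 P f phi] !=set0.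
Proof.
move=> r0 e0; pose f : encoder X n r := fun _ => Ordinal (nb_messages_gt0 n r0).
pose phi : detector Y n r := fun _ => false.
exists (err1 P f phi), f, phi; split=> //.
by rewrite /err0 big1// => xy; rewrite !inE.
Qed.

Lemma beta_ge n (eps r : R) : (0 < n)%N -> 0 <= r -> 0 <= eps -> eps < 1 ->
  expR (- ((n%:R * xi P r * ln 2 + 1) / (1 - eps))) <= beta P n eps r.
Proof.
move=> n0 r0 e0 e1; apply: lb_le_inf; first exact: beta_set_nonempty.
(* [L] is chosen so that [(1 - eps) * L] exceeds the right side of [data_processing] by 1; an error
   below [expR (- L)] would make the subtracted term less than 1. *)
move=> _ [f [phi [h0 ->]]]; set L := _ / _; rewrite leNgt; apply/negP => h1.
have e1' : 0 < 1 - eps by rewrite subr_gt0.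
have D := data_processing f phi n0 r0 L.
have L0 : 0 <= L.
  apply: divr_ge0 (ltW e1'); rewrite addr_ge0// !mulr_ge0//; first exact: xi_ge0.
  exact: ltW (ln2_gt0 R).
have h2 : expR L * err1 P f phi < 1.
  by rewrite -(ltr_pM2l (expR_gt0 L)) -expRD subrr expR0 in h1.
have h3 : (1 - eps) * L <= (1 - err0 P f phi) * L by rewrite ler_wpM2r// lerD2l lerN2.
have h4 : (1 - eps) * L = n%:R * xi P r * ln 2 + 1 by rewrite mulrC divfK// gt_eqF.
lra.
Qed.

Lemma ln2_ge_half : 2^-1 <= ln (2 : R).
Proof.
have := @ln_le_subr1 R 2^-1; rewrite invr_gt0 ltr0n lnV ?posrE// => /(_ isT); lra.
Qed.

(** For [eps <= 1/2], the inverse of [1 - eps] is at most both [1 + 2 eps] and 2. The former, with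
    [xi <= C], gives the term in [eps]; the latter, with [1 / ln 2 <= 2], gives the constant 4. *)
Lemma exponent_gap_le n (eps r : R) : (0 < n)%N -> 0 <= r -> 0 <= eps -> eps <= 2^-1 ->
  exponent_gap P n eps r <= 2 * fine (llr_bound P) * eps + 4 / n%:R.
Proof.
move=> n0 r0 e0 e12; have e1 : eps < 1 by lra.
have nR : 0 < n%:R :> R by rewrite ltr0n.
have b := beta_ge n0 r0 e0 e1.
have b0 : 0 < beta P n eps r by apply: lt_le_trans b; exact: expR_gt0.
rewrite /exponent_gap /log2.
have : - ln (beta P n eps r) <= (n%:R * xi P r * ln 2 + 1) / (1 - eps).
  by rewrite lerNl -ler_expR lnK.
have x0 := xi_ge0 hP hC r0; have xC := xi_le hP hC r0.
set C := fine _ in xC *; set x := xi P r in x0 xC *; set l := ln (beta _ _ _ _).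
have l2 := ln2_gt0 R; have l2' := ln2_ge_half.
have i1 : (1 - eps)^-1 <= 1 + 2 * eps.
  by rewrite invf_ple ?posrE; [|lra..]; rewrite -div1r ler_pdivrMr; [nra|lra].
have i2 : (1 - eps)^-1 <= 2 by lra.
have i3 : (ln 2)^-1 <= 2 :> R by rewrite invf_ple ?posrE//; lra.
move=> hl.
have : - l / (n%:R * ln 2) <= x * (1 - eps)^-1 + (1 - eps)^-1 * (ln 2)^-1 / n%:R.
  rewrite ler_pdivrMr ?mulr_gt0//; apply: le_trans hl _.
  rewrite le_eqVlt; apply/orP; left; apply/eqP; field; lra.
have -> : - n%:R^-1 * (l / ln 2) = - l / (n%:R * ln 2) by field; lra.
have : (1 - eps)^-1 * (ln 2)^-1 / n%:R <= 4 / n%:R.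
  have e' : 0 <= (1 - eps)^-1 by rewrite invr_ge0; lra.
  have l' : 0 <= (ln 2)^-1 :> R by rewrite invr_ge0; lra.
  rewrite ler_pM2r ?invr_gt0//; apply: le_trans (ler_pM e' l' i2 i3) _; lra.
have : x * (1 - eps)^-1 <= x * (1 + 2 * eps) by rewrite ler_wpM2l.
nra.
Qed.
End Converse.

(** * Greedy covering *)

Section Covering.
Variable R : realType.
Implicit Types A B V : finType.

(** Averaged over [pV], the newly covered mass is at least [alpha] times the uncovered mass, so some
    letter achieves this. Codewords of positive mass are required because the type II bound divides
    by [pV v]. *)
Lemma greedy_covering A V (pA : A -> R) (pV : V -> R) (good : V -> A -> bool)
    (S : pred A) (alpha : R) m :
  is_pmf pA -> is_pmf pV -> 0 <= alpha <= 1 ->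
  (forall a, S a -> alpha * pA a <= pA a * \sum_v pV v * (good v a)%:R) ->
  exists cb : seq V, [/\ size cb = m, forall v, v \in cb -> pV v != 0 &
    \sum_(a | S a && ~~ has (good^~ a) cb) pA a <= (1 - alpha) ^+ m].
Proof.
move=> [pA0 pA1] [pV0 pV1] /andP[al0 al1] hS; elim: m => [|m [cb [sz cbV IH]]].
  exists [::]; split=> //; rewrite expr0 -pA1 [leRHS](bigID S)/=.
  by under eq_bigl do rewrite andbT; rewrite lerDl sumr_ge0.
pose N a := S a && ~~ has (good^~ a) cb.
pose mu := \sum_(a | N a) pA a.
pose gain v := \sum_(a | N a) pA a * (good v a)%:R.
have avg : alpha * mu <= \sum_v pV v * gain v.
  rewrite mulr_sumr; under [leRHS]eq_bigr do rewrite mulr_sumr.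
  rewrite exchange_big; apply: ler_sum => a /andP[Sa _].
  apply: le_trans (hS a Sa) _; rewrite mulr_sumr; apply: ler_sum => v _.
  by rewrite mulrCA.
(* Otherwise every letter of positive mass would fall strictly below the average, which the equality
   case of a vanishing sum of nonnegative terms excludes. *)
have [v [vV vgain]] : exists v, pV v != 0 /\ alpha * mu <= gain v.
  apply: contrapT => /forallNP h.
  have gap v : 0 <= pV v * (alpha * mu - gain v).
    have [->|v0] := eqVneq (pV v) 0; first by rewrite mul0r.
    rewrite mulr_ge0// subr_ge0 leNgt; apply/negP => g.
    by apply: (h v); rewrite v0 ltW.
  have gap0 : \sum_v pV v * (alpha * mu - gain v) = 0.
    apply: le_anti; rewrite sumr_ge0// andbT.
    under eq_bigr do rewrite mulrBr; rewrite sumrB -mulr_suml pV1 mul1r.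
    by rewrite subr_le0.
  suff : \sum_v pV v = 0 by rewrite pV1 => /eqP; rewrite oner_eq0.
  apply: big1 => v _; apply/eqP; apply: contrapT => /negP v0.
  have /eqP := psumr_eq0P (fun v _ => gap v) gap0 (i := v) isT.
  rewrite mulf_eq0 (negbTE v0) subr_eq0 => /eqP e.
  by apply: (h v); rewrite e.
exists (v :: cb); split; first by rewrite /= sz.
  by move=> v'; rewrite inE => /orP[/eqP->//|]; exact: cbV.
have -> : \sum_(a | S a && ~~ has (good^~ a) (v :: cb)) pA a = mu - gain v.
  rewrite /mu /gain -sumrB [RHS]big_mkcond [LHS]big_mkcond; apply: eq_bigr => a _ /=.
  rewrite negb_or /N; case: (S a) => //=; case: (good v a) => /=; case: (has _ _) => //=.
    by rewrite mulr1 subrr.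
  by rewrite mulr0 subr0.
apply: le_trans (_ : mu - alpha * mu <= _); first by rewrite lerD2l lerN2.
rewrite exprS -{1}[mu]mul1r -mulrBl ler_wpM2l// subr_ge0//.
Qed.

(** * A one-shot code from an arbitrary coupling *)

Section one_shot.
Variables (A B V : finType) (pA : A -> R) (k : A -> B -> R) (w : V -> A -> R).
Hypotheses (hpA : is_pmf pA) (hk : channel k) (cw : coupling pA w).
Let pV v := \sum_a w v a.
Let J v := push k (w v).
Let pB := push k pA.
Variables (tau T c e1 e2 : R).
Hypotheses (tau0 : 0 <= tau) (c0 : 0 < c).
Hypothesis he1 : \sum_v \sum_a w v a * (expR tau * (pV v * pA a) < w v a)%R%:R <= e1.
Hypothesis he2 : \sum_v \sum_b J v b * (J v b < expR T * (pV v * pB b))%R%:R <= e2.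

(** This is the probability that, from input [a], the likelihood ratio test for the codeword [v]
    rejects. Below, an input of positive mass is in [S] when, conditionally on it, the codeword is
    good with probability at least one half. *)
Let miss v a := \sum_b k a b * (J v b < expR T * (pV v * pB b))%R%:R.
Let good v a := (w v a <= expR tau * (pV v * pA a)) && (miss v a <= c).
Let S a := pA a / 2 <= \sum_v w v a * (good v a)%:R.

Lemma one_shot_pV : is_pmf pV.
Proof.
by split=> [v|]; [apply: sumr_ge0 => a _; exact: cw.1|rewrite (coupling_mass cw) hpA.2].
Qed.

Lemma one_shot_miss_ge0 v a : 0 <= miss v a.
Proof. by apply: sumr_ge0 => b _; rewrite mulr_ge0// hk.1. Qed.

(** Markov's inequality for [miss]: under the coupling it exceeds [c] with probability at most
    [e2 / c]. *)
Lemma one_shot_bad : \sum_v \sum_a w v a * (~~ good v a)%:R <= e1 + e2 / c.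
Proof.
have w0 := cw.1.
apply: (@le_trans _ _ (\sum_v \sum_a (w v a * (expR tau * (pV v * pA a) < w v a)%R%:R +
    w v a * miss v a / c))).
  apply: ler_sum => v _; apply: ler_sum => a _; rewrite -mulrA -mulrDr ler_wpM2l//.
  have m0 := one_shot_miss_ge0 v a.
  rewrite /good negb_and -!ltNge; case: (_ < w v a) => /=.
    by rewrite lerDl divr_ge0// ltW.
  rewrite add0r; have [cm|_] := ltP c (miss v a); last by rewrite divr_ge0// ltW.
  by rewrite ler_pdivlMr// mul1r ltW.
under eq_bigr do rewrite big_split/= -mulr_suml.
rewrite big_split/= -mulr_suml lerD// ler_wpM2r ?invr_ge0 ?(ltW c0)//.
apply: le_trans he2; rewrite le_eqVlt; apply/orP; left; apply/eqP.
apply: eq_bigr => v _; under eq_bigr do rewrite mulr_sumr.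
rewrite exchange_big; apply: eq_bigr => b _.
by under eq_bigr do rewrite mulrA; rewrite -mulr_suml.
Qed.

(** Outside [S] more than half of the mass of an input sits on bad codewords, whence the factor
    2. *)
Lemma one_shot_bad_inputs : \sum_(a | ~~ S a) pA a <= 2 * (e1 + e2 / c).
Proof.
apply: le_trans (_ : 2 * \sum_v \sum_a w v a * (~~ good v a)%:R <= _); last first.
  by rewrite ler_wpM2l// one_shot_bad.
have w0 := cw.1; have t0 v a : 0 <= w v a * (~~ good v a)%:R by rewrite mulr_ge0.
rewrite exchange_big mulr_sumr [leRHS](bigID S)/= -[leLHS]add0r lerD//.
  by apply: sumr_ge0 => a _; rewrite mulr_ge0// sumr_ge0.
apply: ler_sum => a; rewrite /S -ltNge => h.
have : pA a = \sum_v w v a * (good v a)%:R + \sum_v w v a * (~~ good v a)%:R.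
  rewrite -cw.2 -big_split; apply: eq_bigr => v _ /=.
  by case: (good v a); rewrite ?mulr1 ?mulr0 ?addr0 ?add0r.
lra.
Qed.

(** Type I: the input lies outside [S], or escapes the codebook, or is rejected by the test of a
    codeword good for it. Type II: for a fixed codeword [v], an accepted [b] satisfies
    [pB b <= expR (- T) * J v b / pV v], and the row [J v] has total mass [pV v]. *)
Lemma one_shot M : (0 < M)%N ->
  exists (f : A -> 'I_M) (phi : 'I_M * B -> bool),
    \sum_a \sum_b pA a * k a b * (phi (f a, b))%:R <=
      2 * (e1 + e2 / c) + c + (1 - expR (- tau) / 2) ^+ M /\
    \sum_a \sum_b pA a * pB b * (phi (f a, b) == false)%:R <= expR (- T).
Proof.
move=> M0; have [w0 wA] := cw; have [pA0 pA1] := hpA; have [pV0 pV1] := one_shot_pV.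
(* One half comes from membership in [S], and [expR (- tau)] from the passage from the coupling to
   the product law, which the density bound in [good] permits. *)
pose alpha := expR (- tau) / 2.
have al : 0 <= alpha <= 1.
  rewrite divr_ge0 ?expR_ge0//= ler_pdivrMr// mul1r.
  have : expR (- tau) <= 1 by rewrite expR_le1 oppr_le0.
  lra.
have hS a : S a -> alpha * pA a <= pA a * \sum_v pV v * (good v a)%:R.
  rewrite /S => h; apply: le_trans (_ : expR (- tau) * \sum_v w v a * (good v a)%:R <= _).
    by rewrite /alpha mulrAC -mulrA ler_wpM2l ?expR_ge0.
  rewrite !mulr_sumr; apply: ler_sum => v _.
  rewrite mulrA [leRHS]mulrA; case: (boolP (good v a)) => [|_]; last by rewrite !mulr0.
  move=> /andP[g _]; rewrite !mulr1 expRN mulrC ler_pdivrMr ?expR_gt0//.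
  by rewrite mulrC [pA a * _]mulrC.
have [cb [sz cbV cov]] := greedy_covering M hpA one_shot_pV al hS.
have [v0 _] : exists v0 : V, True.
  by case: cb sz {cbV cov} => [M0'|v0 ? _]; [rewrite -M0' in M0|exists v0].
pose i0 : 'I_M := Ordinal M0.
(* The message is the index of the first codeword good for the input. When there is none, the
   default message 0 is sent and the bound below counts a certain error. *)
pose f a : 'I_M := insubd i0 (find (good^~ a) cb).
pose phi (ib : 'I_M * B) := J (nth v0 cb ib.1) ib.2 < expR T * (pV (nth v0 cb ib.1) * pB ib.2).
exists f, phi; split.
  apply: (@le_trans _ _ (\sum_a pA a * ((~~ S a)%:R + (S a && ~~ has (good^~ a) cb)%:R + c))).
    apply: ler_sum => a _; under eq_bigr do rewrite -mulrA.
    rewrite -mulr_sumr ler_wpM2l//.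
    have le1 : \sum_b k a b * (phi (f a, b))%:R <= 1.
      rewrite -[leRHS](hk.2 a); apply: ler_sum => b _; have := hk.1 a b.
      by case: (phi _); rewrite ?mulr1 ?mulr0.
    have [Sa|_] := boolP (S a); last first.
      by apply: le_trans le1 _; rewrite /= addr0 lerDl ltW.
    rewrite add0r /=; have [hg|_] := boolP (has (good^~ a) cb); last first.
      by apply: le_trans le1 _; rewrite /= lerDl ltW.
    rewrite add0r; have lt := hg; rewrite has_find sz in lt.
    have -> : \sum_b k a b * (phi (f a, b))%:R = miss (nth v0 cb (f a)) a by [].
    rewrite /f val_insubd lt.
    by have /andP[] := nth_find v0 hg.
  under eq_bigr do rewrite !mulrDr; rewrite !big_split/= -mulr_suml pA1 mul1r.
  have mk (Q : pred A) : \sum_a pA a * (Q a)%:R = \sum_(a | Q a) pA a.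
    rewrite [RHS]big_mkcond; apply: eq_bigr => a _.
    by case: (Q a); rewrite ?mulr1 ?mulr0.
  rewrite (mk (fun a => ~~ S a)) (mk (fun a => S a && ~~ has (good^~ a) cb)).
  have := one_shot_bad_inputs; rewrite -/alpha; lra.
rewrite -[expR (- T)]mul1r -[X in _ <= X * _]pA1 mulr_suml; apply: ler_sum => a _.
under eq_bigr do rewrite -mulrA.
rewrite -mulr_sumr ler_wpM2l//.
set v := nth v0 cb (f a).
have pVv : 0 < pV v.
  by rewrite lt_neqAle eq_sym pV0 andbT cbV// mem_nth// sz.
have pB0 b : 0 <= pB b by exact: push_ge0.
have J0 b : 0 <= J v b by exact: push_ge0.
rewrite -(ler_pM2l pVv) -(ler_pM2l (expR_gt0 T)).
rewrite [leRHS]mulrCA -expRD subrr expR0 mulr1 [leRHS]/pV -[leRHS](push_mass _ hk).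
rewrite !mulr_sumr; apply: ler_sum => b _; rewrite /phi/= -/v.
case: ltP => [_|h]; first by rewrite !mulr0 J0.
by rewrite mulr1.
Qed.
End one_shot.

End Covering.

(** * Concentration of information densities *)

Section Concentration.
Variable R : realType.
Implicit Types A B U : finType.

(* A second moment bound suffices here, so that the exponent [z] in [chernoff] need not
   be bounded below: input densities may be arbitrarily small. *)
Lemma expR_le_quadratic (x : R) : x <= 3^-1 -> expR x <= 1 + x + x ^+ 2.
Proof.
(* Squaring [expR y <= 1 / (1 - y)] reduces the claim to [0 <= y^2 (1 - 6 y + 4 y^2)], and
   [6 y <= 1] is the hypothesis on [x]. *)
move=> x3; pose y := x / 2; have xE : x = y + y by rewrite /y; lra.
have y6 : 6 * y <= 1 by rewrite /y; lra.
have E0 := expR_gt0 y; have h : (1 - y) * expR y <= 1.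
  rewrite -ler_pdivlMr// div1r -expRN; exact: expR_ge1Dx.
have h2 : ((1 - y) * expR y) ^+ 2 <= 1.
  by rewrite expr_le1// mulr_ge0 ?ltW//; lra.
have h3 : 1 <= (1 + x + x ^+ 2) * (1 - y) ^+ 2.
  have -> : (1 + x + x ^+ 2) * (1 - y) ^+ 2 = 1 + y ^+ 2 * (1 - 6 * y + 4 * y ^+ 2).
    by rewrite xE; ring.
  by have y2 := sqr_ge0 y; rewrite lerDl mulr_ge0//; lra.
have y1 : 0 < (1 - y) ^+ 2 by rewrite exprn_gt0//; lra.
rewrite -(ler_pM2r y1); apply: le_trans h3; apply: le_trans h2.
by rewrite xE expRD exprMn mulrC -expr2.
Qed.

Lemma sum_tuple_prod2 U A (g : U -> A -> R) n :
  \sum_us \sum_as' @memoryless R U A g n us as' = (\sum_u \sum_a g u a) ^+ n.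
Proof.
under eq_bigr do rewrite (sum_tuple_prod (fun i a => g (tnth _ i) a)).
by rewrite (sum_tuple_prod (fun _ u => \sum_a g u a)) prodr_const card_ord.
Qed.

(** Exponential Markov inequality, each factor having mean at most [1 + s mu + s^2 K] by
    [expR_le_quadratic]. The event [E] is only asked to force a large sum on tuples of positive
    joint mass, where the densities substituted for [z] are meaningful. *)
Lemma chernoff U A (w z : U -> A -> R) n (s K delta : R)
    (E : n.-tuple U -> n.-tuple A -> bool) :
  (forall u a, 0 <= w u a) -> \sum_u \sum_a w u a = 1 -> 0 <= s ->
  (forall u a, 0 < w u a -> s * z u a <= 3^-1) ->
  \sum_u \sum_a w u a * z u a ^+ 2 <= K ->
  (forall us t, (forall i, 0 < w (tnth us i) (tnth t i)) -> E us t ->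
    n%:R * (\sum_u \sum_a w u a * z u a + delta) <= \sum_(i < n) z (tnth us i) (tnth t i)) ->
  \sum_us \sum_t memoryless w us t * (E us t)%:R <= expR (- (n%:R * (s * delta - s ^+ 2 * K))).
Proof.
move=> w0 w1 s0 sz hK hE; set mu := \sum_u \sum_a w u a * z u a in hE.
pose g u a := w u a * expR (s * z u a).
apply: (@le_trans _ _ (\sum_us \sum_t
  expR (- (s * (n%:R * (mu + delta)))) * @memoryless R U A g n us t)).
  apply: ler_sum => us _; apply: ler_sum => t _.
  have -> : memoryless g us t =
      memoryless w us t * expR (s * \sum_(i < n) z (tnth us i) (tnth t i)).
    by rewrite mulr_sumr expR_sum -big_split.
  rewrite mulrCA; have p0 : 0 <= memoryless w us t by exact: prodr_ge0.
  have [->|pn0] := eqVneq (memoryless w us t) 0; first by rewrite !mul0r.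
  rewrite ler_wpM2l//; case: (boolP (E us t)) => [Et|_]; last first.
    by rewrite mulr_ge0 ?expR_ge0.
  rewrite -expRD mulr1n -[leLHS]expR0 ler_expR addrC subr_ge0 ler_wpM2l// hE// => i.
  rewrite lt_neqAle w0 andbT eq_sym; apply: contra_neq pn0 => wi.
  by rewrite /memoryless (bigD1 i)//= wi mul0r.
under eq_bigr do rewrite -mulr_sumr.
rewrite -mulr_sumr sum_tuple_prod2.
have gle : \sum_u \sum_a g u a <= expR (s * mu + s ^+ 2 * K).
  apply: le_trans (expR_ge1Dx _).
  apply: (@le_trans _ _ (\sum_u \sum_a
    (w u a + s * (w u a * z u a) + s ^+ 2 * (w u a * z u a ^+ 2)))).
    apply: ler_sum => u _; apply: ler_sum => a _.
    have [wu0|wu0] := leP (w u a) 0.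
      have w00 : w u a = 0 by apply: le_anti; rewrite wu0 w0.
      by rewrite /g w00 !mul0r !mulr0 !addr0.
    have -> : w u a + s * (w u a * z u a) + s ^+ 2 * (w u a * z u a ^+ 2) =
      w u a * (1 + s * z u a + (s * z u a) ^+ 2) by ring.
    by rewrite ler_wpM2l// expR_le_quadratic// sz.
  under eq_bigr do rewrite 2!big_split/= -!mulr_sumr.
  by rewrite 2!big_split/= w1 -!mulr_sumr -!addrA !lerD2l ler_wpM2l// sqr_ge0.
have g0 : 0 <= \sum_u \sum_a g u a.
  by do 2![apply: sumr_ge0 => ? _]; rewrite mulr_ge0// expR_ge0.
apply: le_trans (_ : expR (- (s * (n%:R * (mu + delta)))) * expR (s * mu + s ^+ 2 * K) ^+ n <= _).
  by rewrite ler_wpM2l ?expR_ge0// lerXn2r// nnegrE ?expR_ge0.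
rewrite -expRM_natl -expRD ler_expR le_eqVlt; apply/orP; left; apply/eqP; ring.
Qed.

Section tails.
Variables (U A : finType) (pA : A -> R) (w : U -> A -> R) (n : nat) (s K delta : R).
Hypotheses (hpA : is_pmf pA) (cw : coupling pA w) (s0 : 0 <= s).

Let dens u a := w u a / ((\sum_a' w u a') * pA a).

Lemma memoryless_row_mass us :
  \sum_t @memoryless R U A w n us t = iid_pmf (fun u => \sum_a w u a) us.
Proof. by rewrite (sum_tuple_prod (fun i a => w (tnth us i) a)). Qed.

Lemma coupling_memoryless : coupling (@iid_pmf R A pA n) (@memoryless R U A w n).
Proof.
split=> [us t|t]; first by apply: prodr_ge0 => i _; exact: cw.1.
rewrite (sum_tuple_prod (fun i u => w u (tnth t i))).
by apply: eq_bigr => i _; exact: cw.2.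
Qed.

Lemma coupling_dens_gt0 u a : 0 < w u a -> 0 < (\sum_a' w u a') * pA a.
Proof.
move=> wu; apply: mulr_gt0.
  exact: lt_le_trans wu (coupling_le_row _ _ cw).
exact: lt_le_trans wu (coupling_le_col _ _ cw).
Qed.

Lemma memoryless_dens (us : n.-tuple U) (t : n.-tuple A) :
  (forall i, 0 < w (tnth us i) (tnth t i)) ->
  memoryless w us t = expR (\sum_(i < n) ln (dens (tnth us i) (tnth t i))) *
    ((\sum_t' memoryless w us t') * iid_pmf pA t).
Proof.
move=> wi; rewrite memoryless_row_mass expR_sum -!big_split; apply: eq_bigr => i _ /=.
have d0 := coupling_dens_gt0 (wi i).
by rewrite lnK ?posrE ?divr_gt0// divfK// gt_eqF.
Qed.

Lemma memoryless_mass_gt0 (us : n.-tuple U) (t : n.-tuple A) :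
  (forall i, 0 < w (tnth us i) (tnth t i)) ->
  0 < (\sum_t' memoryless w us t') * iid_pmf pA t.
Proof.
move=> wi; rewrite memoryless_row_mass -big_split prodr_gt0// => i _ /=.
exact: coupling_dens_gt0 (wi i).
Qed.

Lemma coupling_total : \sum_u \sum_a w u a = 1.
Proof. by rewrite (coupling_mass cw) hpA.2. Qed.

Hypothesis hK : \sum_u \sum_a w u a * ln (dens u a) ^+ 2 <= K.

Lemma density_upper_tail :
  (forall u a, 0 < w u a -> s * ln (dens u a) <= 3^-1) ->
  \sum_(us : n.-tuple U) \sum_(t : n.-tuple A) memoryless w us t *
    (expR (n%:R * (info pA w + delta)) * ((\sum_t' memoryless w us t') * iid_pmf pA t)
      < memoryless w us t)%R%:R <= expR (- (n%:R * (s * delta - s ^+ 2 * K))).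
Proof.
move=> sd; apply: (chernoff (z := fun u a => ln (dens u a)) cw.1 coupling_total) => //.
move=> us t wi; rewrite [X in _ < X]memoryless_dens// ltr_pM2r; last exact: memoryless_mass_gt0.
by rewrite ltr_expR => /ltW.
Qed.

Lemma density_lower_tail :
  (forall u a, 0 < w u a -> - (s * ln (dens u a)) <= 3^-1) ->
  \sum_(us : n.-tuple U) \sum_(t : n.-tuple A) memoryless w us t *
    (memoryless w us t < expR (n%:R * (info pA w - delta)) *
      ((\sum_t' memoryless w us t') * iid_pmf pA t))%R%:R
    <= expR (- (n%:R * (s * delta - s ^+ 2 * K))).
Proof.
move=> sd; apply: (chernoff (z := fun u a => - ln (dens u a)) cw.1 coupling_total) => //.
- by move=> u a wu; rewrite mulrN sd.
- by under eq_bigr do under eq_bigr do rewrite sqrrN.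
move=> us t wi; rewrite [X in X < _]memoryless_dens// ltr_pM2r; last exact: memoryless_mass_gt0.
rewrite ltr_expR => /ltW; rewrite sumrN.
under [X in _ -> n%:R * (X + _) <= _]eq_bigr do under eq_bigr do rewrite mulrN.
under [X in _ -> n%:R * (X + _) <= _]eq_bigr do rewrite sumrN.
by rewrite sumrN lerNr -mulrN opprD opprK.
Qed.
End tails.

(** * Input densities: bounds uniform in the auxiliary variable *)

Section input_moments.
Variables (U A : finType) (pA : A -> R) (w : U -> A -> R).
Hypotheses (hpA : is_pmf pA) (cw : coupling pA w).

(** It dominates [- ln (pA a)] for every [a]; letters of mass 0 contribute nothing because
    [ln 0 = 0]. *)
Definition log_range : R := \sum_a `|ln (pA a)|.

Lemma input_density_le u a : 0 < w u a ->
  ln (w u a / ((\sum_a' w u a') * pA a)) <= log_range.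
Proof.
move=> wu; have := coupling_dens_gt0 cw wu; set m := \sum_a' w u a' => mp.
have wm : w u a <= m := coupling_le_row _ _ cw.
have m0 : 0 < m by apply: lt_le_trans wm.
have p0 : 0 < pA a by rewrite pmulr_rgt0 in mp.
rewrite ln_div ?posrE// lnM ?posrE// opprD addrA.
have : ln (w u a) <= ln m by rewrite ler_ln.
have : - ln (pA a) <= log_range.
  apply: le_trans (_ : `|ln (pA a)| <= _); first by rewrite -normrN ler_norm.
  by rewrite /log_range (bigD1 a)//= lerDl sumr_ge0.
lra.
Qed.

(** The density is unbounded below, but when the conditional mass of [a] given [u] is [expR (- y)],
    the product [expR (- y) * y ^+ 2] is at most 2. Each pair thus contributes at most
    [4 + 2 * log_range ^+ 2] times the mass of its row. *)
Lemma input_second_moment :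
  \sum_u \sum_a w u a * ln (w u a / ((\sum_a' w u a') * pA a)) ^+ 2 <=
    #|A|%:R * (4 + 2 * log_range ^+ 2).
Proof.
set S := 4 + _; have S0 : 0 <= S by rewrite addr_ge0// mulr_ge0// sqr_ge0.
have -> : #|A|%:R * S = \sum_u \sum_(a : A) (\sum_a' w u a') * S.
  under eq_bigr do rewrite sumr_const -[_ *+ _]mulr_natr mulrAC.
  by rewrite -mulr_suml -mulr_suml (coupling_mass cw) hpA.2 mul1r mulrC.
apply: ler_sum => u _; apply: ler_sum => a _; set m := \sum_a' w u a'.
have wm : w u a <= m := coupling_le_row _ _ cw.
have [w0|wu] := leP (w u a) 0.
  have w00 : w u a = 0 by apply: le_anti; rewrite w0 cw.1.
  by rewrite w00 mul0r mulr_ge0// -w00.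
have mp := coupling_dens_gt0 cw wu; rewrite -/m in mp.
have m0 : 0 < m by apply: lt_le_trans wm.
have p0 : 0 < pA a by rewrite pmulr_rgt0 in mp.
pose y := - ln (w u a / m); have t0 : 0 < w u a / m by rewrite divr_gt0.
have tE : w u a = m * expR (- y) by rewrite opprK lnK// mulrC divfK// gt_eqF.
have y0 : 0 <= y by rewrite oppr_ge0 ln_le0// ler_pdivrMr// mul1r.
have -> : ln (w u a / (m * pA a)) = - y - ln (pA a).
  by rewrite invfM mulrA ln_div// opprK.
rewrite {1}tE -mulrA ler_wpM2l ?(ltW m0)//.
have e1 : expR (- y) <= 1 by rewrite expR_le1 oppr_le0.
have e0 := expR_gt0 (- y).
have h1 : expR (- y) * y ^+ 2 <= 2.
  rewrite expRN mulrC ler_pdivrMr ?expR_gt0//.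
  have := expR_ge1Dxn 1 y0; rewrite (_ : 2`!%:R = 2 :> R)//; lra.
have h2 : ln (pA a) ^+ 2 <= log_range ^+ 2.
  rewrite -[leLHS]real_normK ?num_real// ler_sqr ?nnegrE ?sumr_ge0//.
  by rewrite /log_range (bigD1 a)//= lerDl sumr_ge0.
have h3 : expR (- y) * ln (pA a) ^+ 2 <= log_range ^+ 2.
  by apply: le_trans h2; rewrite ler_piMl// sqr_ge0.
have h4 : (- y - ln (pA a)) ^+ 2 <= 2 * y ^+ 2 + 2 * ln (pA a) ^+ 2.
  rewrite -subr_ge0 (_ : _ - _ = (y - ln (pA a)) ^+ 2) ?sqr_ge0//; ring.
have h5 := ler_wpM2l (ltW e0) h4; rewrite /S; lra.
Qed.
End input_moments.

End Concentration.

(** * Achievability *)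

(** The tails are [expR (- 4N)] so that dividing by the threshold [expR (- 2N)] still leaves
    [expR (- 2N)]. The total is at most six terms of that size, and [expR N >= 1 + N >= 6]. *)
Lemma error_budget (R : realType) (N a : R) M : 5 <= N -> 0 <= a <= 1 -> 2 * N <= M%:R * a ->
  2 * (expR (- (4 * N)) + expR (- (4 * N)) / expR (- (2 * N))) + expR (- (2 * N)) +
    (1 - a) ^+ M <= expR (- N).
Proof.
move=> N5 /andP[a0 a1] Na.
have e2 : expR (- (4 * N)) = expR (- (2 * N)) * expR (- (2 * N)).
  by rewrite -expRD; congr expR; ring.
have EN : expR (- (2 * N)) = expR (- N) * expR (- N) by rewrite -expRD; congr expR; ring.
have E0 := expR_gt0 (- (2 * N)); set E := expR (- (2 * N)) in e2 EN E0 *.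
have E1 : E <= 1 by rewrite expR_le1 oppr_le0; lra.
have hM : (1 - a) ^+ M <= E.
  apply: le_trans (_ : expR (- a) ^+ M <= _).
    by rewrite lerXn2r ?nnegrE ?expR_ge0 ?subr_ge0// expR_ge1Dx.
  by rewrite -expRM_natl ler_expR mulrN lerN2.
have -> : expR (- (4 * N)) / E = E by rewrite e2 mulfK// gt_eqF.
have N6 : 6 * expR (- N) <= 1.
  rewrite expRN ler_pdivrMr ?expR_gt0// mul1r; apply: le_trans (expR_ge1Dx N); lra.
have E6 : 6 * E <= expR (- N).
  rewrite EN mulrA -[leRHS]mul1r; apply: ler_wpM2r N6; exact: expR_ge0.
have : expR (- (4 * N)) <= E by rewrite e2 ler_piMl// ltW.
lra.
Qed.

Section Achievability.
Variables (R : realType) (X Y : finType) (P : X * Y -> R).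
Hypothesis hP : is_pmf P.
Hypothesis hC : (llr_bound P < +oo)%E.

Lemma push_memoryless_row (U A B : finType) (k : A -> B -> R) (w : U -> A -> R) n
    (us : n.-tuple U) :
  push (@memoryless R A B k n) (memoryless w us) = memoryless (fun u => push k (w u)) us.
Proof.
apply/funext => s.
rewrite /push /memoryless -(sum_tuple_prod (fun i a => w (tnth us i) a * k a (tnth s i))).
by apply: eq_bigr => t _; rewrite -big_split.
Qed.

Let c := fine (llr_bound P) * ln 2.
Let L := log_range (fst_marg P).

(** A common constant for both tail bounds: the first term controls the second moment of the input
    density, the second that of the output density. *)
Definition moment_bound : R := #|X|%:R * (4 + 2 * L ^+ 2) + c ^+ 2.

Lemma output_second_moment (U : finType) (w : U -> X -> R) : coupling (fst_marg P) w ->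
  \sum_u \sum_y push (transition P) (w u) y *
    ln (push (transition P) (w u) y /
      ((\sum_y' push (transition P) (w u) y') * snd_marg P y)) ^+ 2 <= c ^+ 2.
Proof.
move=> cw; have hV := transition_channel hP; have cV := coupling_push hV cw.
rewrite push_transition// in cV.
have -> : c ^+ 2 = \sum_u \sum_y push (transition P) (w u) y * c ^+ 2.
  under eq_bigr do rewrite -mulr_suml; rewrite -mulr_suml (coupling_mass cV).
  by rewrite (snd_marg_pmf hP).2 mul1r.
apply: ler_sum => u _; apply: ler_sum => y _.
have [->|J0] := eqVneq (push (transition P) (w u) y) 0; first by rewrite !mul0r.
have {}J0 : 0 < push (transition P) (w u) y by rewrite lt_neqAle eq_sym J0 cV.1.
rewrite ler_wpM2l ?(ltW J0)// push_mass//.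
have := output_density_bound hP hC (cw.1 u) J0; rewrite -/c => h.
rewrite -[leLHS]real_normK ?num_real// ler_sqr ?nnegrE//.
exact: le_trans (normr_ge0 _) h.
Qed.

(** This is [one_shot] for the [n]-fold memoryless coupling, with [tau = n (i1 + delta)],
    [T = n (i2 - delta)] and [c = expR (- 2N)], where [i1] and [i2] are the input and output
    informations. *)
Lemma beta_le_of_coupling (U : finType) (w : U -> X -> R) n (r s delta N eps : R) :
  coupling (fst_marg P) w -> 0 <= r -> 0 <= s -> 0 <= delta -> s * (L + c) <= 3^-1 ->
  5 <= N -> 4 * N <= n%:R * (s * delta - s ^+ 2 * moment_bound) ->
  2 * N <= (nb_messages n r)%:R * (expR (- (n%:R * (info (fst_marg P) w + delta))) / 2) ->
  expR (- N) <= eps ->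
  beta P n eps r <=
    expR (- (n%:R * (info (snd_marg P) (fun u => push (transition P) (w u)) - delta))).
Proof.
move=> cw r0 s0 d0 sb N5 Ns Nr Neps.
have pX := fst_marg_pmf hP; have pY := snd_marg_pmf hP; have hV := transition_channel hP.
have c0 : 0 <= c by rewrite mulr_ge0 ?llr_bound_ge0// ltW// ln2_gt0.
have L0 : 0 <= L by apply: sumr_ge0.
have cV := coupling_push hV cw; rewrite push_transition// in cV.
have pXn := is_pmf_iid n pX; have hVn := channel_memoryless n hV.
have cwn := coupling_memoryless n cw.
set wY := fun u => push (transition P) (w u) in cV *.
set i1 := info (fst_marg P) w in Nr *; set i2 := info (snd_marg P) _.
have i10 : 0 <= i1 by exact: info_ge0 cw pX.2.
have Kle K : K <= moment_bound ->
    expR (- (n%:R * (s * delta - s ^+ 2 * K))) <= expR (- (4 * N)).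
  move=> hK; rewrite ler_expR lerN2; apply: le_trans Ns _; rewrite ler_wpM2l//.
  by rewrite lerD2l lerN2 ler_wpM2l// sqr_ge0.
have sL : s * L <= 3^-1.
  by apply: le_trans sb; rewrite ler_wpM2l// lerDl.
have sc : s * c <= 3^-1.
  by apply: le_trans sb; rewrite ler_wpM2l// lerDr.
have he1 : \sum_(us : n.-tuple U) \sum_(t : n.-tuple X) memoryless w us t *
    (expR (n%:R * (i1 + delta)) * ((\sum_t' memoryless w us t') * iid_pmf (fst_marg P) t)
      < memoryless w us t)%R%:R <= expR (- (4 * N)).
  apply: le_trans (density_upper_tail n delta pX cw s0 (input_second_moment pX cw) _) _.
    move=> u x wu; apply: le_trans sL; rewrite ler_wpM2l//.
    exact: input_density_le.
  by apply: Kle; rewrite lerDl sqr_ge0.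
have he2 : \sum_(us : n.-tuple U) \sum_(t : n.-tuple Y)
    push (@memoryless R X Y (transition P) n) (memoryless w us) t *
    (push (@memoryless R X Y (transition P) n) (memoryless w us) t <
      expR (n%:R * (i2 - delta)) * ((\sum_t' memoryless w us t') *
        push (@memoryless R X Y (transition P) n) (@iid_pmf R X (fst_marg P) n) t))%R%:R
    <= expR (- (4 * N)).
  rewrite push_memoryless push_transition//.
  under eq_bigr do under eq_bigr do rewrite -(push_mass _ hVn) push_memoryless_row.
  apply: le_trans (density_lower_tail n delta pY cV s0 (output_second_moment cw) _) _.
    move=> u y wu; apply: le_trans sc; rewrite -mulrN ler_wpM2l//.
    rewrite lerNl; have := output_density_bound hP hC (cw.1 u) wu.
    by rewrite push_mass// ler_norml => /andP[].
  apply: Kle; rewrite lerDr mulr_ge0// addr_ge0// mulr_ge0// sqr_ge0//.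
have tau0 : 0 <= n%:R * (i1 + delta) by rewrite mulr_ge0// addr_ge0.
have [f [phi [h0 h1]]] := one_shot pXn hVn cwn tau0 (expR_gt0 (- (2 * N))) he1 he2
  (nb_messages_gt0 n r0).
apply: le_trans h1 => {he1 he2}.
apply: ge_inf.
  by exists 0 => _ [f' [phi' [_ ->]]]; rewrite err1E//; do 2![apply: sumr_ge0 => ? _];
    rewrite !mulr_ge0// iid_pmf_ge0//; [exact: pX.1|exact: pY.1].
exists f, phi; split; last first.
  by rewrite err1E// push_memoryless push_transition.
apply: le_trans Neps.
have -> : err0 P f phi = \sum_t \sum_s0 iid_pmf (fst_marg P) t * memoryless (transition P) t s0 *
    (phi (f t, s0))%:R.
  have tot : \sum_t \sum_s0
      @iid_pmf R X (fst_marg P) n t * @memoryless R X Y (transition P) n t s0 = 1.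
    by under eq_bigr do rewrite -mulr_sumr hVn.2 mulr1; exact: pXn.2.
  rewrite -[LHS](subKr 1) err0E// -[X in X - _]tot -sumrB; apply: eq_bigr => t _.
  rewrite -sumrB; apply: eq_bigr => t' _.
  by case: (phi _); rewrite ?mulr1 ?mulr0 ?subr0 ?subrr.
apply: le_trans h0 _.
set M := nb_messages n r in Nr *; set tau := n%:R * (i1 + delta) in Nr tau0 *.
have t1 : expR (- tau) <= 1 by rewrite expR_le1 oppr_le0.
apply: error_budget Nr => //.
rewrite divr_ge0 ?expR_ge0//= ler_pdivrMr// mul1r (le_trans t1)//.
by rewrite ler1n.
Qed.
End Achievability.

Lemma nb_messages_ge (R : realType) n (r : R) : 0 <= r ->
  expR (n%:R * r * ln 2) <= 2 * (nb_messages n r)%:R.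
Proof.
move=> r0; rewrite -two_powR; have M0 := nb_messages_gt0 n r0.
have /truncn_itv/andP[_ /ltW h] := powR_ge0 2 (n%:R * r).
apply: le_trans h _; rewrite -/(nb_messages n r) -natr1 mulrDl mul1r lerD2l.
by rewrite ler1n.
Qed.

(** The rate holds [2 * delta] in reserve. One [delta] pays for the density threshold; the other
    supplies a factor [expR (n * delta)], at least half the square of [n * delta] and hence at least
    [8 * N] as [kappa >= 4]. Of this 8, a factor 2 covers the rounding of the number of messages and
    another the half in the covering probability. *)
Lemma rate_budget (R : realType) n (r i delta kappa s N : R) :
  (0 < n)%N -> 0 <= r -> 4 <= kappa -> 0 <= s -> delta = kappa * s -> n%:R * s ^+ 2 = N ->
  i + 2 * delta <= r * ln 2 ->
  2 * N <= (nb_messages n r)%:R * (expR (- (n%:R * (i + delta))) / 2).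
Proof.
move=> n0 r0 k4 s0 dE NE hi.
have n1 : 1 <= n%:R :> R by rewrite ler1n.
have d0 : 0 <= delta by rewrite dE mulr_ge0//; lra.
have nd0 : 0 <= n%:R * delta by rewrite mulr_ge0.
have N0 : 0 <= N by rewrite -NE mulr_ge0// sqr_ge0.
have h1 : 8 * N <= expR (n%:R * delta).
  have := expR_ge1Dxn 1 nd0; rewrite (_ : 2`!%:R = 2 :> R)// => h.
  have -> : 8 * N = (n%:R * delta) ^+ 2 / 2 * (16 / (n%:R * kappa ^+ 2)).
    by rewrite -NE dE; field; lra.
  apply: le_trans (_ : (n%:R * delta) ^+ 2 / 2 <= _); last by apply: le_trans h; rewrite lerDr.
  rewrite ler_piMr ?divr_ge0 ?sqr_ge0// ler_pdivrMr; last first.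
    by rewrite mulr_gt0 ?exprn_gt0//; lra.
  rewrite mul1r; apply: le_trans (_ : 1 * kappa ^+ 2 <= _); last by rewrite ler_wpM2r// sqr_ge0.
  by rewrite mul1r (_ : 16 = 4 ^+ 2) ?ler_sqr ?nnegrE//; [lra|ring].
have h2 : expR (n%:R * delta) <= expR (n%:R * r * ln 2) * expR (- (n%:R * (i + delta))).
  rewrite -expRD ler_expR -subr_ge0.
  rewrite (_ : _ - _ = n%:R * (r * ln 2 - (i + 2 * delta))); last by ring.
  by rewrite mulr_ge0// subr_ge0.
have h3 := ler_wpM2r (expR_ge0 (- (n%:R * (i + delta)))) (nb_messages_ge n r0).
lra.
Qed.

(** Three losses add up: [s] for the approximation of [xi], [theta * C] for the erasure, since
    [xi <= C], and [kappa * s / l2] for the slack in the output density. *)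
Lemma gap_budget (R : realType) (x C r s kappa l2 theta J : R) :
  0 < r -> 0 < l2 -> 0 < s -> 0 <= kappa -> x <= C -> 0 <= x ->
  theta = 2 * (kappa * s) / (r * l2) -> theta <= 1 -> x - s < J / l2 ->
  - (s * (1 + 2 * kappa * C / (r * l2) + kappa / l2)) <=
    ((1 - theta) * J - kappa * s) / l2 - x.
Proof.
move=> r0 l0 s0 k0 xC x0 tE t1 hJ.
have t0 : 0 <= theta by rewrite tE divr_ge0 ?mulr_ge0 ?(ltW s0) ?(ltW r0) ?(ltW l0).
have -> : ((1 - theta) * J - kappa * s) / l2 = (1 - theta) * (J / l2) - kappa * s / l2.
  by field; rewrite gt_eqF.
have -> : s * (1 + 2 * kappa * C / (r * l2) + kappa / l2) = s + theta * C + kappa * s / l2.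
  by rewrite tE; field; rewrite !gt_eqF.
have h : (1 - theta) * (x - s) <= (1 - theta) * (J / l2).
  by rewrite ler_wpM2l ?subr_ge0// ltW.
have h1 : theta * x <= theta * C by rewrite ler_wpM2l.
have h2 : 0 <= theta * s by rewrite mulr_ge0// ltW.
rewrite mulrBl !mulrBr !mul1r in h; lra.
Qed.

Section AchievabilityGap.
Variables (R : realType) (X Y : finType) (P : X * Y -> R).
Hypothesis hP : is_pmf P.
Hypothesis hC : (llr_bound P < +oo)%E.

Lemma moment_bound_ge0 : 0 <= moment_bound P.
Proof. by rewrite addr_ge0 ?sqr_ge0// mulr_ge0// addr_ge0// mulr_ge0// sqr_ge0. Qed.

(** With [delta = kappa * s], the choice of [kappa] makes the Chernoff exponent
    [s * delta - s ^+ 2 * moment_bound P] equal to [4 * s ^+ 2], which is [4 * N / n], as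
    [error_budget] demands. It also gives the [4 <= kappa] of [rate_budget]. *)
Lemma exponent_gap_ge_scale n (r s N eps : R) (kappa := moment_bound P + 4) :
  (0 < n)%N -> 0 < r -> 0 < s ->
  s * (log_range (fst_marg P) + fine (llr_bound P) * ln 2) <= 3^-1 ->
  5 <= N -> n%:R * s ^+ 2 = N -> 2 * (kappa * s) <= r * ln 2 ->
  expR (- N) <= eps -> eps < 1 ->
  - (s * (1 + 2 * kappa * fine (llr_bound P) / (r * ln 2) + kappa / ln 2)) <=
    exponent_gap P n eps r.
Proof.
move=> n0 r0 s0 sb N5 NE ks Neps eps1.
have K0 := moment_bound_ge0; have l2 := ln2_gt0 R.
have k4 : 4 <= kappa by rewrite /kappa; lra.
have nR : 0 < n%:R :> R by rewrite ltr0n.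
have eps0 : 0 <= eps by apply: le_trans Neps; exact: expR_ge0.
have rl : 0 < r * ln 2 by rewrite mulr_gt0.
have [U [w0 [cw0 i0 j0]]] := xi_approx hP hC (ltW r0) s0.
(* The erased fraction lowers the rate [r * ln 2] by exactly the reserve [2 * (kappa * s)]. *)
pose theta := 2 * (kappa * s) / (r * ln 2).
have k0 : 0 <= kappa by lra.
have t0 : 0 <= theta.
  by apply: divr_ge0 (ltW rl); rewrite mulr_ge0// mulr_ge0// ltW.
have t1 : theta <= 1 by rewrite ler_pdivrMr// mul1r.
have pX := fst_marg_pmf hP; have hV := transition_channel hP.
have cc := coupling_const pX.
have t0' : 0 <= 1 - theta by rewrite subr_ge0.
have t1' : 1 - theta <= 1 by rewrite lerBlDr lerDl.
(* Erasure is time sharing with a constant variable, which carries no information. *)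
pose w := mixture (1 - theta) w0 (fun _ : unit => fst_marg P).
have cw : coupling (fst_marg P) w by exact: mixture_coupling.
have iw : info (fst_marg P) w = (1 - theta) * info (fst_marg P) w0.
  by rewrite mixture_info// info_const// mulr0 addr0.
have jw : info (snd_marg P) (fun u => push (transition P) (w u)) =
    (1 - theta) * info (snd_marg P) (fun u => push (transition P) (w0 u)).
  rewrite mixture_info_push// push_transition//.
  by rewrite info_const ?mulr0 ?addr0//; exact: snd_marg_pmf.
have hi : info (fst_marg P) w + 2 * (kappa * s) <= r * ln 2.
  have : (1 - theta) * info (fst_marg P) w0 <= (1 - theta) * (r * ln 2).
    by rewrite ler_wpM2l// -ler_pdivrMr.
  have tE : theta * (r * ln 2) = 2 * (kappa * s) by rewrite divfK// gt_eqF.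
  by move=> h; rewrite iw -tE; apply: le_trans (lerD h (lexx _)) _; rewrite -mulrDl subrK mul1r.
have Ns : 4 * N <= n%:R * (s * (kappa * s) - s ^+ 2 * moment_bound P).
  by rewrite -NE /kappa le_eqVlt; apply/orP; left; apply/eqP; ring.
have d0 : 0 <= kappa * s by rewrite mulr_ge0 ?(ltW s0).
have hr := rate_budget n0 (ltW r0) k4 (ltW s0) erefl NE hi.
have bl := beta_le_of_coupling hP hC cw (ltW r0) (ltW s0) d0 sb N5 Ns hr Neps.
have b0 : 0 < beta P n eps r.
  exact: lt_le_trans (expR_gt0 _) (beta_ge hP hC n0 (ltW r0) eps0 eps1).
have := gap_budget r0 l2 s0 k0 (xi_le hP hC (ltW r0)) (xi_ge0 hP hC (ltW r0)) erefl t1 j0.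
move=> /le_trans; apply; rewrite /exponent_gap lerD2r /log2 -jw.
set j := info _ _ - _ in bl *.
have : n%:R * j <= - ln (beta P n eps r).
  by rewrite lerNr -[leRHS]expRK ler_ln// posrE expR_gt0.
move=> hj; rewrite mulrA ler_pM2r ?invr_gt0// mulNr -mulrN ler_pdivlMl//.
Qed.
End AchievabilityGap.

(** * Asymptotics *)

Section Growth.
Variable R : realType.

Lemma near_powR_ge (a M : R) : 0 < a -> \forall n \near \oo, M <= n%:R `^ a.
Proof.
move=> a0; pose M' := Num.max M 1.
near=> n.
apply: (@le_trans _ _ M'); first by rewrite le_max lexx.
have M'0 : 0 < M' by rewrite lt_max ltr01 orbT.
have -> : M' = (M' `^ a^-1) `^ a by rewrite -powRrM mulVf ?gt_eqF// powRr1// ltW.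
apply: ge0_ler_powR; rewrite ?nnegrE ?powR_ge0 ?(ltW a0)//.
near: n; exact: nbhs_infty_ger.
Unshelve. all: end_near. Qed.

Lemma near_log2_ge (M : R) : \forall n \near \oo, M <= log2 n%:R.
Proof.
near=> n; rewrite /log2 ler_pdivlMr ?ln2_gt0// -ler_expR lnK.
  by near: n; exact: nbhs_infty_ger.
by rewrite posrE ltr0n; near: n; exact: nbhs_infty_gt.
Unshelve. all: end_near. Qed.

Lemma log2_ge (x y : R) : expR (x * ln 2) <= y -> x <= log2 y.
Proof.
move=> h; rewrite /log2 ler_pdivlMr ?ln2_gt0// -ler_expR lnK// posrE.
exact: lt_le_trans (expR_gt0 _) h.
Qed.

Lemma log2_le_nat n : log2 (n%:R : R) <= n%:R.
Proof.
rewrite /log2 ler_pdivrMr ?ln2_gt0//; case: n => [|n].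
  by rewrite ln0// mul0r.
rewrite -ler_expR lnK ?posrE ?ltr0n// -two_powR powR_mulrn// -natrX ler_nat.
by rewrite ltnW// ltn_expl.
Qed.

Lemma near_expR_root_le (p : R) : 0 < p ->
  \forall n \near \oo, expR (- (n%:R `^ (1 / 3))) <= 1 / n%:R `^ p.
Proof.
move=> p0; near=> n.
have n0 : 0 < n%:R :> R by rewrite ltr0n; near: n; exact: nbhs_infty_gt.
(* Of the two factors [n^(1/6)] of [n^(1/3)], one absorbs the constant [6 p] and the other dominates
   its own logarithm. *)
have h6 : 6 * p <= n%:R `^ (1 / 6) by near: n; apply: near_powR_ge; rewrite divr_gt0.
have pE (a : R) : n%:R `^ a = expR (a * ln n%:R) by rewrite /powR (gt_eqF n0).
rewrite [leRHS]div1r -powRN (pE (- p)) ler_expR mulNr lerN2.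
have -> : n%:R `^ (1 / 3) = n%:R `^ (1 / 6) * n%:R `^ (1 / 6) :> R.
  by rewrite !pE -expRD; congr expR; field.
have -> : p * ln n%:R = 6 * p * ln (n%:R `^ (1 / 6)) by rewrite ln_powR; field.
apply: le_trans (_ : 6 * p * n%:R `^ (1 / 6) <= _); last by rewrite ler_wpM2r// powR_ge0.
by rewrite ler_wpM2l ?mulr_ge0 ?(ltW p0)// ltW// ln_sublinear// powR_gt0.
Unshelve. all: end_near. Qed.

Lemma cvg_div_log2 (K : R) : K / log2 n%:R @[n --> \oo] --> (0 : R).
Proof.
apply/cvgr0Pnorm_le => e e0; near=> n.
have h : `|K| / e + 1 <= log2 n%:R by near: n; exact: near_log2_ge.
have k0 : 0 <= `|K| / e by rewrite divr_ge0 ?(ltW e0).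
have l0 : 0 < log2 n%:R :> R by apply: lt_le_trans h; rewrite ltr_wpDl.
rewrite normrM normfV (gtr0_norm l0) ler_pdivrMr// mulrC -ler_pdivrMr//.
by apply: le_trans h; rewrite lerDl.
Unshelve. all: end_near. Qed.
End Growth.

Section Bounds.
Variables (R : realType) (X Y : finType) (P : X * Y -> R).
Hypothesis hP : is_pmf P.
Hypothesis hC : (llr_bound P < +oo)%E.

(** The scale is [s = n^(-(1-q)/2)], so that [N = n s^2 = n^q]. Since [eps] is quantified after [n],
    the constant and the threshold serve all levels at once, and the bound applies to a sequence of
    levels. *)
Lemma exponent_gap_ge (q r : R) : 0 < q -> q < 1 -> 0 < r ->
  exists2 K : R, 0 <= K & \forall n \near \oo, forall eps : R,
    expR (- (n%:R `^ q)) <= eps -> eps < 1 ->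
    - (K / n%:R `^ ((1 - q) / 2)) <= exponent_gap P n eps r.
Proof.
move=> q0 q1 r0; have l2 := ln2_gt0 R; have K0 := moment_bound_ge0 P.
pose kappa := moment_bound P + 4; have k0 : 0 <= kappa by rewrite addr_ge0.
have C0 := llr_bound_ge0 hP hC.
exists (1 + 2 * kappa * fine (llr_bound P) / (r * ln 2) + kappa / ln 2).
  have rl : 0 <= r * ln 2 by rewrite mulr_ge0 ?ltW.
  have h1 : 0 <= 2 * kappa * fine (llr_bound P) / (r * ln 2).
    by apply: divr_ge0 => //; rewrite mulr_ge0// mulr_ge0.
  have h2 : 0 <= kappa / ln 2 by apply: divr_ge0 => //; exact: ltW.
  by rewrite !addr_ge0.
have q2 : 0 < (1 - q) / 2 by rewrite divr_gt0// subr_gt0.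
pose B := log_range (fst_marg P) + fine (llr_bound P) * ln 2.
near=> n.
have hB : 3 * B <= n%:R `^ ((1 - q) / 2) by near: n; exact: near_powR_ge.
have hk : 2 * kappa / (r * ln 2) <= n%:R `^ ((1 - q) / 2).
  by near: n; exact: near_powR_ge.
have hN : 5 <= n%:R `^ q by near: n; exact: near_powR_ge.
have n0 : (0 < n)%N by near: n; exact: nbhs_infty_gt.
have nR : 0 < n%:R :> R by rewrite ltr0n.
move=> eps heps eps1; set D := n%:R `^ ((1 - q) / 2) in hB hk *; have D0 : 0 < D by exact: powR_gt0.
rewrite mulrC; apply: (exponent_gap_ge_scale hP hC) heps eps1 => //.
- by rewrite invr_gt0.
- by rewrite -/B mulrC ler_pdivrMr//; lra.
- have -> : D^-1 = n%:R `^ (- ((1 - q) / 2)) by rewrite powRN.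
  rewrite expr2 -{1}(@powRr1 _ n%:R)// -!powRD ?(gt_eqF nR) ?implybT//.
  by congr powR; field.
- rewrite ler_pdivrMr ?mulr_gt0// in hk.
  by rewrite -/kappa mulrA ler_pdivrMr// [leRHS]mulrC.
Unshelve. all: end_near. Qed.

Lemma lower_bound_form (gap dD b K l m m' : R) : dD <= 0 -> 0 <= b -> 0 <= K ->
  0 < l -> 0 < m -> m <= m' -> - (K / m') <= gap -> (dD - b - K / l) * (l / m) <= gap.
Proof.
move=> d0 b0 K0 l0 m0 mm' h; apply: le_trans h.
have lm : 0 < l / m by rewrite divr_gt0.
apply: (@le_trans _ _ (- (K / m))); last first.
  by rewrite lerN2 ler_wpM2l// lef_pV2// posrE (lt_le_trans m0).
have -> : - (K / m) = - (K / l) * (l / m) by field; rewrite !gt_eqF.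
by rewrite ler_wpM2r ?(ltW lm)//; lra.
Qed.
End Bounds.

Section SmallNumbers.
Variable R : realType.

Lemma near_exp_le_inv_log2 : \forall n \near \oo, expR (- (n%:R `^ (1 / 3))) <= 1 / log2 n%:R :> R.
Proof.
near=> n.
have l0 : 1 <= log2 n%:R :> R by near: n; exact: near_log2_ge.
have n0 : 0 < n%:R :> R by rewrite ltr0n; near: n; exact: nbhs_infty_gt.
apply: le_trans (_ : 1 / n%:R `^ 1 <= _); first by near: n; exact: near_expR_root_le.
have l0' : 0 < log2 n%:R :> R by lra.
by rewrite powRr1 ?(ltW n0)// ler_pM2l// lef_pV2 ?posrE// log2_le_nat.
Unshelve. all: end_near. Qed.

Lemma near_log2_log2_ge (M : R) : \forall n \near \oo, M <= log2 (log2 n%:R).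
Proof. by near=> n; apply: log2_ge; near: n; exact: near_log2_ge.
Unshelve. all: end_near. Qed.

Lemma sqrt_ge_self (y : R) : 0 <= y -> y <= 1 -> y <= Num.sqrt y.
Proof.
move=> y0 y1; rewrite -[leLHS]ger0_norm// -sqrtr_sqr ler_sqrt//.
by rewrite expr2 ler_piMr.
Qed.
End SmallNumbers.

(** * Both bounds for each sequence of type I errors *)

Section Exponents.
Variables (R : realType) (X Y : finType) (P : X * Y -> R) (r : R).
Hypothesis hP : is_pmf P.
Hypothesis hC : (llr_bound P < +oo)%E.
Hypothesis r0 : 0 < r.

Let C := fine (llr_bound P).
Let dD := derive1 (noisy_dist_rate P) r.

Lemma near_gap_ge (q a e : R) (b eps : nat -> R) : 0 < q -> q < 1 -> 0 <= a ->
  e <= (1 - q) / 2 ->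
  (\forall n \near \oo, 0 <= b n) ->
  (\forall n \near \oo, expR (- (n%:R `^ q)) <= eps n) ->
  (\forall n \near \oo, eps n < 1) ->
  exists2 o : nat -> R, o n @[n --> \oo] --> (0 : R) &
    \forall n \near \oo, exponent_gap P n (eps n) r >=
      (a * dD - b n - o n) * (log2 n%:R / n%:R `^ e).
Proof.
move=> q0 q1 a0 eq b0 h0 h1.
have [K K0 hK] := exponent_gap_ge hP hC q0 q1 r0.
exists (fun n => K / log2 n%:R); first exact: cvg_div_log2.
near=> n.
have n1 : (0 < n)%N by near: n; exact: nbhs_infty_gt.
have nR : 1 <= n%:R :> R by rewrite ler1n.
have l1 : 1 <= log2 n%:R :> R by near: n; exact: near_log2_ge.
apply: (@lower_bound_form _ _ _ _ K _ _ (n%:R `^ ((1 - q) / 2))) => //.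
- by rewrite mulr_ge0_le0// derive1_noisy_dist_rate_le0.
- by near: n.
- exact: lt_le_trans l1.
- by rewrite powR_gt0// (lt_le_trans _ nR).
- exact: ler_powR.
- have hKn : forall eps, expR (- n%:R `^ q) <= eps -> eps < 1 ->
     - (K / n%:R `^ ((1 - q) / 2)) <= exponent_gap P n eps r by near: n.
  by apply: hKn; near: n.
Unshelve. all: end_near. Qed.

Lemma near_gap_le (eps : nat -> R) (F : nat -> R) :
  (\forall n \near \oo, 0 <= eps n <= 2^-1) ->
  (\forall n \near \oo, 2 * C * eps n + 4 / n%:R <= F n) ->
  \forall n \near \oo, exponent_gap P n (eps n) r <= F n.
Proof.
move=> h1 h2; near=> n.
have n1 : (0 < n)%N by near: n; exact: nbhs_infty_gt.
have /andP[e0 e1] : 0 <= eps n <= 2^-1 by near: n.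
apply: le_trans (exponent_gap_le hP hC n1 (ltW r0) e0 e1) _.
by near: n.
Unshelve. all: end_near. Qed.

Lemma near_inv_log2_le : \forall n \near \oo, 0 <= (1 / log2 n%:R : R) <= 2^-1.
Proof.
near=> n; have l2 : 2 <= log2 n%:R :> R by near: n; exact: near_log2_ge.
rewrite div1r invr_ge0 lef_pV2 ?posrE; lra.
Unshelve. all: end_near. Qed.

Lemma near_inv_powR_le (p : R) : 0 < p -> \forall n \near \oo, 0 <= (1 / n%:R `^ p : R) <= 2^-1.
Proof.
move=> p0; near=> n; have l2 : 2 <= n%:R `^ p :> R by near: n; exact: near_powR_ge.
by rewrite div1r invr_ge0 powR_ge0 lef_pV2 ?posrE//; lra.
Unshelve. all: end_near. Qed.

Lemma near_inv_expR_le (p : R) : 0 < p ->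
  \forall n \near \oo, 0 <= (1 / expR (n%:R `^ p) : R) <= 2^-1.
Proof.
move=> p0; near=> n; have l2 : 1 <= n%:R `^ p :> R by near: n; exact: near_powR_ge.
rewrite div1r invr_ge0 expR_ge0 lef_pV2 ?posrE ?expR_gt0//.
have := expR_ge1Dx (n%:R `^ p : R); lra.
Unshelve. all: end_near. Qed.

(** The converse leaves [2 C / log n + 4 / n]: the first term fits because [1 / log n] is at most
    its square root, the second because [log (log n) >= 4] eventually. *)
Lemma gap_log_upper : \forall n \near \oo, exponent_gap P n (1 / log2 n%:R) r <=
  (16 * C + log2 (log2 n%:R) * Num.sqrt (log2 n%:R) / n%:R) * (1 / Num.sqrt (log2 n%:R)).
Proof.
have C0 := llr_bound_ge0 hP hC.
apply: (near_gap_le near_inv_log2_le); near=> n.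
have l1 : 1 <= log2 n%:R :> R by near: n; exact: near_log2_ge.
have ll : 4 <= log2 (log2 n%:R) :> R by near: n; exact: near_log2_log2_ge.
have n1 : (0 < n)%N by near: n; exact: nbhs_infty_gt.
have nR : 0 < n%:R :> R by rewrite ltr0n.
set l := log2 n%:R in l1 ll *; set m := log2 l in ll *.
have s1 : 1 <= Num.sqrt l by rewrite -[leLHS]sqrtr1 ler_sqrt//; lra.
have sl : l = Num.sqrt l ^+ 2 by rewrite sqr_sqrtr//; lra.
set s := Num.sqrt l in s1 sl *.
have -> : (16 * C + m * s / n%:R) * (1 / s) = 16 * C * s^-1 + m / n%:R by field; lra.
have h1 : 1 / l <= s^-1.
  by rewrite div1r lef_pV2 ?posrE; [rewrite sl expr2 ler_peMl//; lra|lra..].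
have h2 : 4 / n%:R <= m / n%:R by rewrite ler_pM2r// invr_gt0.
have s0 : 0 <= s^-1 by rewrite invr_ge0; lra.
have h3 : 2 * C * (1 / l) <= 2 * C * s^-1 by rewrite ler_wpM2l// mulr_ge0.
have h4 : 0 <= C * s^-1 by rewrite mulr_ge0.
lra.
Unshelve. all: end_near. Qed.

Lemma gap_powR_upper (p : R) : 0 < p -> \forall n \near \oo,
  exponent_gap P n (1 / n%:R `^ p) r <=
  (16 * C + p * log2 n%:R / n%:R `^ (1 - p / 2)) * (1 / n%:R `^ (p / 2)).
Proof.
move=> p0; have C0 := llr_bound_ge0 hP hC.
apply: (near_gap_le (near_inv_powR_le p0)); near=> n.
have l1 : 4 / p <= log2 n%:R :> R by near: n; exact: near_log2_ge.
have n1 : (0 < n)%N by near: n; exact: nbhs_infty_gt.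
have nR : 0 < n%:R :> R by rewrite ltr0n.
have nR1 : 1 <= n%:R :> R by rewrite ler1n.
set l := log2 n%:R in l1 *; rewrite ler_pdivrMr// in l1.
set s := n%:R `^ (p / 2); have s0 : 0 < s by exact: powR_gt0.
set t := n%:R `^ (1 - p / 2); have t0 : 0 < t by exact: powR_gt0.
have st : t * s = n%:R.
  by rewrite -powRD ?(gt_eqF nR) ?implybT// subrK powRr1 ?(ltW nR).
have -> : (16 * C + p * l / t) * (1 / s) = 16 * C * s^-1 + p * l / n%:R.
  by rewrite -st; field; rewrite !gt_eqF.
have sp : s <= n%:R `^ p by apply: ler_powR => //; lra.
have h1 : 1 / n%:R `^ p <= s^-1.
  by rewrite div1r lef_pV2// posrE powR_gt0.
have h2 : 4 / n%:R <= p * l / n%:R by rewrite ler_pM2r ?invr_gt0// mulrC.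
have s0' : 0 <= s^-1 by rewrite invr_ge0 ltW.
have h3 : 2 * C * (1 / n%:R `^ p) <= 2 * C * s^-1 by rewrite ler_wpM2l// mulr_ge0.
have h4 : 0 <= C * s^-1 by rewrite mulr_ge0.
lra.
Unshelve. all: end_near. Qed.

(** Common form of the upper bounds in the last two regimes, where [g n] is [n^2 eps_n]. The term
    [4 / n] is absorbed once [log n >= 2]. *)
Lemma gap_upper_form (eps : nat -> R) (g : nat -> R) :
  (\forall n \near \oo, 0 <= eps n <= 2^-1) ->
  (\forall n \near \oo, n%:R * eps n <= Num.sqrt (g n + 1)) ->
  \forall n \near \oo, exponent_gap P n (eps n) r <=
    (8 * Num.sqrt 2 * C * (Num.sqrt (g n + 1) / log2 n%:R) + 2) * (log2 n%:R / n%:R).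
Proof.
move=> he hg; have C0 := llr_bound_ge0 hP hC.
apply: (near_gap_le he); near=> n.
have l2 : 2 <= log2 n%:R :> R by near: n; exact: near_log2_ge.
have n1 : (0 < n)%N by near: n; exact: nbhs_infty_gt.
have nR : 0 < n%:R :> R by rewrite ltr0n.
have hgn : n%:R * eps n <= Num.sqrt (g n + 1) by near: n.
set l := log2 n%:R in l2 *; set s := Num.sqrt (g n + 1) in hgn *.
have s0 : 0 <= s by exact: sqrtr_ge0.
have s2 : 1 <= Num.sqrt 2 :> R by rewrite -[leLHS]sqrtr1 ler_sqrt//; lra.
have -> : (8 * Num.sqrt 2 * C * (s / l) + 2) * (l / n%:R) =
    8 * Num.sqrt 2 * (C * (s / n%:R)) + 2 * l / n%:R by field; lra.
have h1 : eps n <= s / n%:R by rewrite ler_pdivlMr// mulrC.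
have h2 : 4 / n%:R <= 2 * l / n%:R by rewrite ler_pM2r ?invr_gt0//; lra.
have h3 : C * eps n <= C * (s / n%:R) by rewrite ler_wpM2l.
have h4 : 0 <= C * (s / n%:R) by rewrite mulr_ge0// divr_ge0// ltW.
have h5 : 8 * (C * (s / n%:R)) <= 8 * Num.sqrt 2 * (C * (s / n%:R)).
  by rewrite ler_wpM2r//; lra.
lra.
Unshelve. all: end_near. Qed.
End Exponents.

Unset Implicit Arguments.

Theorem theorem2 (R : realType) (X Y : finType) (P : X * Y -> R) (r : R)
    (hP : is_pmf P) (hI : 0 < mutual_info P) (hC : (llr_bound P < +oo)%E)
    (hr0 : 0 < r) (hrH : r < entropy (fst_marg P)) :
  let C : R := fine (llr_bound P) in
  let dD : R := derive1 (noisy_dist_rate P) r in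
  [/\ (* (i) eps_n = 1 / log n *)
      (exists2 o : nat -> R, o n @[n --> \oo] --> (0 : R) &
        \forall n \near \oo,
          exponent_gap P n (1 / log2 n%:R) r >=
          (1 / 6 * dD - Num.sqrt (2 * ln (log2 n%:R)) * C / log2 n%:R - o n)
          * (log2 n%:R / n%:R `^ (1 / 3)))
      /\
      (\forall n \near \oo,
          exponent_gap P n (1 / log2 n%:R) r <=
          (16 * C + log2 (log2 n%:R) * Num.sqrt (log2 n%:R) / n%:R)
          * (1 / Num.sqrt (log2 n%:R))),
      (* (ii) eps_n = 1 / n ^ p with 0 < p < 2 *)
      forall p : R, 0 < p -> p < 2 ->
      (exists2 o : nat -> R, o n @[n --> \oo] --> (0 : R) &
        \forall n \near \oo,
          exponent_gap P n (1 / n%:R `^ p) r >=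
          (1 / 6 * dD - Num.sqrt (2 * p * ln n%:R) / log2 n%:R * C - o n)
          * (log2 n%:R / n%:R `^ (1 / 3)))
      /\
      (\forall n \near \oo,
          exponent_gap P n (1 / n%:R `^ p) r <=
          (16 * C + p * log2 n%:R / n%:R `^ (1 - p / 2))
          * (1 / n%:R `^ (p / 2))),
      (* (iii) eps_n = 1 / n ^ p with p >= 2 *)
      forall p : R, 2 <= p ->
      (exists2 o : nat -> R, o n @[n --> \oo] --> (0 : R) &
        \forall n \near \oo,
          exponent_gap P n (1 / n%:R `^ p) r >=
          (1 / 6 * dD - Num.sqrt (2 * p * ln n%:R) / log2 n%:R * C - o n)
          * (log2 n%:R / n%:R `^ (1 / 3)))
      /\
      (\forall n \near \oo,
          exponent_gap P n (1 / n%:R `^ p) r <=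
          (8 * Num.sqrt 2 * C * (Num.sqrt (n%:R `^ (2 - p) + 1) / log2 n%:R)
           + 2) * (log2 n%:R / n%:R))
    & (* (iv) eps_n = 1 / e ^ (n ^ p) with 0 < p < 1 *)
      forall p : R, 0 < p -> p < 1 ->
      (exists2 o : nat -> R, o n @[n --> \oo] --> (0 : R) &
        \forall n \near \oo,
          exponent_gap P n (1 / expR (n%:R `^ p)) r >=
          ((1 - p) / 6 * dD - Num.sqrt 2 * C / log2 n%:R - o n)
          * (log2 n%:R / n%:R `^ ((1 - p) / 3)))
      /\
      (\forall n \near \oo,
          exponent_gap P n (1 / expR (n%:R `^ p)) r <=
          (8 * Num.sqrt 2 * C
             * (Num.sqrt (expR (- (n%:R `^ p)) * n%:R ^+ 2 + 1) / log2 n%:R)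
           + 2) * (log2 n%:R / n%:R))].
Proof.
move=> C dD; have C0 : 0 <= C by exact: llr_bound_ge0.
have lt1 (eps : nat -> R) : (\forall n \near \oo, 0 <= eps n <= 2^-1) ->
    \forall n \near \oo, eps n < 1.
  move=> h; near=> n; have /andP[_ h2] : 0 <= eps n <= 2^-1 by near: n.
  by apply: le_lt_trans h2 _; lra.
have l1 : \forall n \near \oo, 0 <= log2 n%:R :> R by exact: near_log2_ge.
have powR_lower (p : R) : 0 < p -> exists2 o : nat -> R, o n @[n --> \oo] --> (0 : R) &
    \forall n \near \oo, exponent_gap P n (1 / n%:R `^ p) r >=
      (1 / 6 * dD - Num.sqrt (2 * p * ln n%:R) / log2 n%:R * C - o n)
      * (log2 n%:R / n%:R `^ (1 / 3)).
  (* The value [q = 1/3] is the one for which [(1 - q) / 2] is the exponent [1/3] of the claim. *)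
  move=> p0; apply: (near_gap_ge hP hC hr0 (q := 1 / 3)); try lra.
  - near=> n; rewrite mulr_ge0// divr_ge0 ?sqrtr_ge0//; near: n; exact: l1.
  - exact: near_expR_root_le.
  - exact: lt1 (near_inv_powR_le p0).
split.
- split; last exact: gap_log_upper.
  apply: (near_gap_ge hP hC hr0 (q := 1 / 3)); try lra.
  + near=> n; apply: divr_ge0; first by rewrite mulr_ge0 ?sqrtr_ge0.
    near: n; exact: l1.
  + exact: near_exp_le_inv_log2.
  + exact: lt1 (near_inv_log2_le R).
- by move=> p p0 _; split; [exact: powR_lower|exact: gap_powR_upper].
- move=> p p2; have p0 : 0 < p by lra.
  split; first exact: powR_lower.
  apply: gap_upper_form => //; first exact: near_inv_powR_le.
  near=> n; have n1 : (0 < n)%N by near: n; exact: nbhs_infty_gt.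
  have nR : 1 <= n%:R :> R by rewrite ler1n.
  apply: (@le_trans _ _ 1).
    rewrite mulrA mulr1 ler_pdivrMr ?powR_gt0 ?ltr0n// mul1r.
    by apply: le1r_powR => //; lra.
  by rewrite -[leLHS]sqrtr1 ler_sqrt ?addr_ge0 ?powR_ge0// lerDr powR_ge0.
- move=> p p0 p1; split.
    apply: (near_gap_ge hP hC hr0 (q := p)); try lra.
    + near=> n; apply: divr_ge0; first by rewrite mulr_ge0 ?sqrtr_ge0.
      near: n; exact: l1.
    + by near=> n; rewrite div1r expRN.
    + exact: lt1 (near_inv_expR_le p0).
  apply: gap_upper_form => //; first exact: near_inv_expR_le.
  near=> n; set y := expR _; rewrite div1r -/y.
  have -> : expR (- n%:R `^ p) = y^-1 by rewrite expRN.
  have y1 : 1 <= y by rewrite -[leLHS]expR0 ler_expR powR_ge0.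
  have yi : 0 <= y^-1 by rewrite invr_ge0; lra.
  (* As [eps_n <= 1], it is at most its square root, and [n] times that root is the square root of
     [n^2 eps_n]. *)
  apply: (@le_trans _ _ (n%:R * Num.sqrt (y^-1))).
    by rewrite ler_wpM2l// sqrt_ge_self// invf_le1//; lra.
  rewrite -{1}(@ger0_norm _ n%:R)// -sqrtr_sqr -sqrtrM ?sqr_ge0//.
  rewrite ler_sqrt; first by rewrite mulrC lerDl.
  by rewrite addr_ge0// mulr_ge0// sqr_ge0.
Unshelve. all: end_near. Qed.
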